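(* Let $K\ge1$, $K'\ge0$, and let $f=h+\overline{g}$ (with $h,g$ analytic in $\mathbb{D}$, $g(0)=0$) be a $(K,K')$-elliptic harmonic mapping in $\mathbb{D}$ with $f(0)=0$ and $\lambda_f(0)=1$. Then $f(\mathbb{D})$ contains a univalent disk of radius at least $$\rho_1=\frac{1}{\sqrt2}+\left(\sqrt2K+\frac{4K'-1}{\sqrt2\left(K+\sqrt{K^2+4K'}\right)}\right)\ln\left(\frac{2K+\frac{4K'-1}{K+\sqrt{K^2+4K'}}}{1+2K+\frac{4K'-1}{K+\sqrt{K^2+4K'}}}\right).$$
   Context: $\mathbb{D}$ is the open unit disk in $\mathbb{C}$. A disk $\Omega$ is called a univalent disk in $f(\mathbb{D})$ if there exists a domain $\Delta\subseteq\mathbb{D}$ such that $f$ maps $\Delta$ univalently (injectively) onto $\Omega$. For a continuously differentiable $f=u+iv$ with $z=x+iy$: $f_z=\frac12(f_x-if_y)$, $f_{\bar z}=\frac12(f_x+if_y)$, $J_f=|f_z|^2-|f_{\bar z}|^2$, $\Lambda_f(z)=|f_z(z)|+|f_{\bar z}(z)|$, and $\lambda_f(z)=\bigl||f_z(z)|-|f_{\bar z}(z)|\bigr|$. $D_f=\begin{pmatrix}u_x&u_y\\ v_x&v_y\end{pmatrix}$, and for a real $2\times2$ matrix $A$, $\|A\|=\sup\{|Az|:|z|=1\}$. A sense-preserving continuous mapping $f$ from $\mathbb{D}$ into $\mathbb{C}$ is $(K,K')$-elliptic (with $K\ge1$, $K'\ge0$) if: (i) $f$ is absolutely continuous on lines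 in $\mathbb{D}$, i.e., for every closed rectangle $R\subset\mathbb{D}$, $f$ is absolutely continuous on almost every line segment in $R$ parallel to the coordinate axes; (ii) $f_z,f_{\bar z}\in L^2(\mathbb{D})$ and $J_f\ne0$ a.e. in $\mathbb{D}$; (iii) $\|D_f\|^2\le KJ_f+K'$ a.e. in $\mathbb{D}$. A mapping $f$ is harmonic on $\mathbb{D}$ if it is twice continuously differentiable and $4f_{z\bar z}=0$ there. A $(K,K')$-elliptic harmonic mapping is a harmonic mapping that is $(K,K')$-elliptic. *)

(* Defs.v *)
From Stdlib Require Import Reals.
From Coquelicot Require Import Coquelicot.
From HB Require Import structures.
From mathcomp Require Import all_boot all_order all_algebra.
From mathcomp Require Import all_classical all_reals all_analysis.
From mathcomp Require Import Rstruct Rstruct_topology.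

Set Implicit Arguments.
Unset Strict Implicit.
Unset Printing Implicit Defensive.

(* The reals are Stdlib's [R] and the complex plane is Coquelicot's
   [C] = [R * R].  Derivatives and continuity are Coquelicot's; Lebesgue
   measure, integrals and plane topology are those of MathComp-Analysis on [R]
   and on the product [R * R]. *)

Local Open Scope classical_set_scope.
Local Open Scope R_scope.

Definition unit_disk : set C := [set z | Cmod z < 1].

Definition disk (c : C) (r : R) : set C := [set z | Cmod (Cminus z c) < r].

Definition domain (A : set C) : Prop :=
  [/\ A !=set0, topology_structure.open A & connected A].

Definition univalent_disk (f : C -> C) (c : C) (r : R) : Prop :=
  0 < r /\
  exists A : set C, [/\ domain A, A `<=` unit_disk & set_bij A (disk c r) f].

(* [Derive] is total, with an unspecified value where the function is not
   differentiable; differentiability is required separately where needed. *)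
Definition px (u : C -> R) (z : C) : R := Derive (fun t => u (t, z.2)) z.1.
Definition py (u : C -> R) (z : C) : R := Derive (fun t => u (z.1, t)) z.2.

Definition re_part (f : C -> C) (z : C) : R := (f z).1.
Definition im_part (f : C -> C) (z : C) : R := (f z).2.

Definition fx (f : C -> C) (z : C) : C := (px (re_part f) z, px (im_part f) z).
Definition fy (f : C -> C) (z : C) : C := (py (re_part f) z, py (im_part f) z).

Definition dz (f : C -> C) (z : C) : C :=
  Cmult (RtoC (1 / 2)) (Cminus (fx f z) (Cmult Ci (fy f z))).
Definition dzbar (f : C -> C) (z : C) : C :=
  Cmult (RtoC (1 / 2)) (Cplus (fx f z) (Cmult Ci (fy f z))).

Definition jacobian (f : C -> C) (z : C) : R :=
  Cmod (dz f z) ^ 2 - Cmod (dzbar f z) ^ 2.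

Definition small_lambda (f : C -> C) (z : C) : R :=
  Rabs (Cmod (dz f z) - Cmod (dzbar f z)).

Definition jacobian_mx (f : C -> C) (z : C) : 'M[R]_2 :=
  \matrix_(i < 2, j < 2)
    let w := if i == ord0 then re_part f else im_part f in
    if j == ord0 then px w z else py w z.

Definition mx_app (A : 'M[R]_2) (z : C) : C :=
  (A ord0 ord0 * z.1 + A ord0 ord_max * z.2,
   A ord_max ord0 * z.1 + A ord_max ord_max * z.2).

Definition mx_opnorm (A : 'M[R]_2) : R :=
  reals.sup [set Cmod (mx_app A z) | z in [set z : C | Cmod z = 1]].

Definition C1_on_disk (u : C -> R) : Prop :=
  forall z : C, unit_disk z ->
    [/\ Coquelicot.Derive.ex_derive (fun t : R => u (t, z.2)) z.1,
        Coquelicot.Derive.ex_derive (fun t : R => u (z.1, t)) z.2,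
        Coquelicot.Continuity.continuous (px u) z & Coquelicot.Continuity.continuous (py u) z].

Definition C2_on_disk (u : C -> R) : Prop :=
  [/\ C1_on_disk u, C1_on_disk (px u) & C1_on_disk (py u)].

Definition harmonic_on_disk (f : C -> C) : Prop :=
  [/\ C2_on_disk (re_part f), C2_on_disk (im_part f) &
      forall z : C, unit_disk z ->
        Cmult (RtoC 4) (dzbar (dz f) z) = RtoC 0].

Definition analytic_on_disk (h : C -> C) : Prop :=
  forall z : C, unit_disk z ->
    @Coquelicot.Derive.ex_derive C_AbsRing C_NormedModule h z.

Definition leb1 := @lebesgue_measure R.

(* Two-dimensional Lebesgue measure, on the Borel sets of [R * R] = [C]; its
   negligible sets are the subsets of Borel null sets. *)
Definition leb2 := (@lebesgue_measure R \x @lebesgue_measure R)%E.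

Definition abs_cont (a b : R) (phi : R -> C) : Prop :=
  forall eps : R, 0 < eps -> exists2 delta : R, 0 < delta &
    forall (n : nat) (s t : 'I_n -> R),
      (forall i, [/\ a <= s i, s i <= t i & t i <= b]) ->
      (forall i j, i <> j -> t i <= s j \/ t j <= s i) ->
      (\sum_(i < n) (t i - s i))%R < delta ->
      (\sum_(i < n) Cmod (Cminus (phi (t i)) (phi (s i))))%R < eps.

Definition ACL_on_disk (f : C -> C) : Prop :=
  forall a b c d : R, a < b -> c < d ->
    (forall x y : R, a <= x <= b -> c <= y <= d -> unit_disk (x, y)) ->
    {ae leb1, forall y : R, c <= y <= d -> abs_cont a b (fun x => f (x, y))} /\
    {ae leb1, forall x : R, a <= x <= b -> abs_cont c d (fun y => f (x, y))}.

Definition ae_on_disk (P : C -> Prop) : Prop :=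
  {ae leb2, forall z : C, unit_disk z -> P z}.

Definition L2_on_disk (p : C -> C) : Prop :=
  measurable_fun
    (unit_disk : set (measurableTypeR R * measurableTypeR R)%type)
    (p : (measurableTypeR R * measurableTypeR R)%type ->
         (measurableTypeR R * measurableTypeR R)%type) /\
  (\int[leb2]_(z in unit_disk) (Rsqr (Cmod (p z)))%:E < +oo)%E.

(* For a continuous mapping having partial derivatives almost everywhere,
   sense-preserving means that the Jacobian is a.e. nonnegative.  For harmonic
   mappings this is implied both by [0 < jacobian f] everywhere and by
   positivity of the local degree. *)
Definition sense_preserving (f : C -> C) : Prop :=
  ae_on_disk (fun z => 0 <= jacobian f z).

Definition elliptic (K K' : R) (f : C -> C) : Prop :=
  [/\ sense_preserving f,
      forall z : C, unit_disk z -> Coquelicot.Continuity.continuous f z,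
      ACL_on_disk f,
      [/\ L2_on_disk (dz f), L2_on_disk (dzbar f) &
          ae_on_disk (fun z => jacobian f z <> 0)] &
      ae_on_disk (fun z =>
        mx_opnorm (jacobian_mx f z) ^ 2 <= K * jacobian f z + K')].

Definition rho1 (K K' : R) : R :=
  1 / sqrt 2 +
  (sqrt 2 * K + (4 * K' - 1) / (sqrt 2 * (K + sqrt (K ^ 2 + 4 * K')))) *
  Rpower.ln ((2 * K + (4 * K' - 1) / (K + sqrt (K ^ 2 + 4 * K'))) /
      (1 + 2 * K + (4 * K' - 1) / (K + sqrt (K ^ 2 + 4 * K')))).

(* Main.v *)
(* Write F = f o Phi, where a maximises (r^2 - |z|^2) lambda_f(z) on the disk
   |z| < r and Phi is the Moebius map of the unit disk onto this disk with
   Phi(0) = a, precomposed with z -> z / sqrt 2.  The maximality gives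
   lambda_F <= 2 lambda_F(0) on the unit disk, and ellipticity then gives
   Lambda_F <= L lambda_F(0) with L = K + sqrt (K^2 + 4 K').  Normalise
   lambda_F(0) = 1 and write F = H + conj G.  The Schwarz lemma for H' + c G',
   |c| = 1, bounds |H'(z) - H'(0)| + |G'(z) - G'(0)| by m |z| / (1 - |z|) with
   m = L - 1/L, so F differs from its differential at 0 by a map whose Lipschitz
   constant on |z| <= rho is less than 1 when rho < 1 / (1 + m).  The contraction
   principle then produces a univalent disk of radius 1 + m ln (m / (1 + m)).
   The choice of a and r <= 1 needs no limit: either (1 - |z|^2) lambda_f(z)
   exceeds its value 1 at the origin somewhere, and then for some r < 1 the
   maximum of (r^2 - |z|^2) lambda_f(z) is at least r, or a = 0, r = 1 will do. *)
Require Import Defs.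
From Stdlib Require Import Reals Lra Psatz FunctionalExtensionality.
From Coquelicot Require Import Coquelicot.
From mathcomp Require all_boot all_order all_algebra all_classical all_reals all_analysis.
From mathcomp Require Rstruct Rstruct_topology.

Local Open Scope R_scope.

(** * Complex differentiability *)

(** The constants come from the chart. Since |Phi'(x)| (1 - |x|^2 / 2) = (r^2 - |Phi(x)|^2) / (sqrt
    2 r), the scaling by 1 / sqrt 2 keeps lambda_F / lambda_F(0) at most 2 on the whole disk, at the
    price that only lambda_F(0) >= 1 / sqrt 2 is known; this is the factor in [rho1]. The normalised
    map satisfies Lambda^2 <= 2 K Lambda + 4 K', whose positive root is L. As L (L - 2 K) = 4 K',
    the number m = L - 1/L is the expression 2 K + (4 K' - 1) / L of [rho1]. The radius 1 / (1 + m)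
    is both where the Lipschitz constant m rho / (1 - rho) reaches 1 and where the covering radius
    (1 + m) rho + m ln (1 - rho) is largest. The function theory stays elementary: holomorphic means
    having a continuous complex derivative, which for h' and g' is read off from f being C^2, and
    the Schwarz lemma rests on circle means alone. Continuity is stated through [Cmod], the common
    ground of the two topologies in use on [C]. *)

Definition ccont (f : C -> C) (z : C) : Prop :=
  forall eps, 0 < eps -> exists d, 0 < d /\
    forall w, Cmod (w - z) < d -> Cmod (f w - f z) < eps.

(* Carathéodory's form of complex differentiability. *)
Definition cderiv (f : C -> C) (z l : C) : Prop :=
  exists p, ccont p z /\ p z = l /\ exists d, 0 < d /\
    forall w, Cmod (w - z) < d -> f w = (f z + p w * (w - z))%C.

Lemma Cmod_minus_sym (a b : C) : Cmod (a - b) = Cmod (b - a).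
Proof. rewrite <- Cmod_opp. f_equal. ring. Qed.

Lemma Cmod_minus_diag (z : C) : Cmod (z - z) = 0.
Proof. replace (z - z)%C with (RtoC 0) by ring. apply Cmod_0. Qed.

Lemma Cmod_triang_minus (a b c : C) : Cmod (a - c) <= Cmod (a - b) + Cmod (b - c).
Proof. replace (a - c)%C with ((a - b) + (b - c))%C by ring. apply Cmod_triangle. Qed.

Lemma Cmod_triangle_inv (a b : C) : Cmod a - Cmod b <= Cmod (a - b).
Proof.
  assert (H := Cmod_triangle (a - b) b).
  replace (a - b + b)%C with a in H by ring. lra.
Qed.

Lemma Cmod_pos (z : C) : z <> 0%C -> 0 < Cmod z.
Proof. intros H. now apply Cmod_gt_0. Qed.

Lemma Cmod_sqr (z : C) : (Cmod z) ^ 2 = fst z ^ 2 + snd z ^ 2.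
Proof. unfold Cmod. rewrite pow2_sqrt; [reflexivity | nra]. Qed.

Lemma fst_le_Cmod (z : C) : Rabs (fst z) <= Cmod z.
Proof. eapply Rle_trans; [apply Rmax_l | apply Rmax_Cmod]. Qed.

Lemma snd_le_Cmod (z : C) : Rabs (snd z) <= Cmod z.
Proof. eapply Rle_trans; [apply Rmax_r | apply Rmax_Cmod]. Qed.

Lemma Cmod_le_abs (z : C) : Cmod z <= Rabs (fst z) + Rabs (snd z).
Proof.
  assert (H := Cmod_sqr z). assert (H0 := Cmod_ge_0 z).
  assert (Ha := pow2_abs (fst z)). assert (Hb := pow2_abs (snd z)).
  assert (H1 := Rabs_pos (fst z)). assert (H2 := Rabs_pos (snd z)). nra.
Qed.

Lemma ccont_ext_loc (f g : C -> C) z d : 0 < d ->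
  (forall w, Cmod (w - z) < d -> f w = g w) -> ccont f z -> ccont g z.
Proof.
  intros hd E H eps he. destruct (H eps he) as [d' [hd' H']].
  exists (Rmin d d'). split; [now apply Rmin_pos|]. intros w hw.
  assert (h1 := Rmin_l d d'). assert (h2 := Rmin_r d d').
  rewrite <- (E w), <- (E z); [apply H'; lra | rewrite Cmod_minus_diag; lra | lra].
Qed.

Lemma ccont_const c z : ccont (fun _ => c) z.
Proof. intros eps he. exists 1. split; [lra|]. intros. rewrite Cmod_minus_diag. lra. Qed.

Lemma ccont_id z : ccont (fun w => w) z.
Proof. intros eps he. exists eps. tauto. Qed.

Lemma ccont_comp f g z : ccont f z -> ccont g (f z) -> ccont (fun w => g (f w)) z.
Proof.
  intros Hf Hg eps he. destruct (Hg eps he) as [d [hd H]].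
  destruct (Hf d hd) as [d' [hd' H']]. exists d'. split; auto.
Qed.

Lemma ccont_plus f g z : ccont f z -> ccont g z -> ccont (fun w => f w + g w)%C z.
Proof.
  intros Hf Hg eps he.
  destruct (Hf (eps / 2)) as [d1 [h1 H1]]; [lra|].
  destruct (Hg (eps / 2)) as [d2 [h2 H2]]; [lra|].
  exists (Rmin d1 d2). split; [now apply Rmin_pos|]. intros w hw.
  assert (a1 := Rmin_l d1 d2). assert (a2 := Rmin_r d1 d2).
  replace (f w + g w - (f z + g z))%C with ((f w - f z) + (g w - g z))%C by ring.
  eapply Rle_lt_trans; [apply Cmod_triangle|].
  specialize (H1 w ltac:(lra)). specialize (H2 w ltac:(lra)). lra.
Qed.

Lemma ccont_conj f z : ccont f z -> ccont (fun w => Cconj (f w)) z.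
Proof.
  intros Hf eps he. destruct (Hf eps he) as [d [h1 H1]]. exists d. split; auto.
  intros w hw. rewrite <- Cminus_conj, Cmod_conj. auto.
Qed.

Lemma ccont_opp f z : ccont f z -> ccont (fun w => - f w)%C z.
Proof.
  intros Hf eps he. destruct (Hf eps he) as [d [h1 H1]]. exists d. split; auto.
  intros w hw. replace (- f w - - f z)%C with (- (f w - f z))%C by ring.
  rewrite Cmod_opp. auto.
Qed.

Lemma ccont_mult f g z : ccont f z -> ccont g z -> ccont (fun w => f w * g w)%C z.
Proof.
  intros Hf Hg eps he.
  set (A := Cmod (f z) + 1). set (B := Cmod (g z) + 1).
  assert (hA : 0 < A) by (unfold A; generalize (Cmod_ge_0 (f z)); lra).
  assert (hB : 0 < B) by (unfold B; generalize (Cmod_ge_0 (g z)); lra).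
  destruct (Hf (eps / (2 * B))) as [d1 [h1 H1]].
  { apply Rdiv_lt_0_compat; lra. }
  destruct (Hg (Rmin 1 (eps / (2 * A)))) as [d2 [h2 H2]].
  { apply Rmin_pos; [lra|]. apply Rdiv_lt_0_compat; lra. }
  exists (Rmin d1 d2). split; [now apply Rmin_pos|]. intros w hw.
  assert (a1 := Rmin_l d1 d2). assert (a2 := Rmin_r d1 d2).
  specialize (H1 w ltac:(lra)). specialize (H2 w ltac:(lra)).
  assert (b1 := Rmin_l 1 (eps / (2 * A))). assert (b2 := Rmin_r 1 (eps / (2 * A))).
  replace (f w * g w - f z * g z)%C
    with ((f w - f z) * g w + f z * (g w - g z))%C by ring.
  eapply Rle_lt_trans; [apply Cmod_triangle|]. rewrite !Cmod_mult.
  assert (hg : Cmod (g w) < B).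
  { assert (h := Cmod_triangle_inv (g w) (g z)). unfold B. lra. }
  assert (E1 : eps / (2 * B) * B = eps / 2) by (field; lra).
  assert (E2 : A * (eps / (2 * A)) = eps / 2) by (field; lra).
  assert (p1 := Cmod_ge_0 (f w - f z)). assert (p2 := Cmod_ge_0 (g w)).
  assert (p3 := Cmod_ge_0 (f z)). assert (p4 := Cmod_ge_0 (g w - g z)).
  assert (Cmod (f w - f z) * Cmod (g w) <= eps / 2) by (rewrite <- E1; apply Rmult_le_compat; lra).
  assert (Cmod (f z) * Cmod (g w - g z) < eps / 2).
  { rewrite <- E2. apply Rle_lt_trans with (Cmod (f z) * (eps / (2 * A))).
    - apply Rmult_le_compat_l; lra.
    - apply Rmult_lt_compat_r; [apply Rdiv_lt_0_compat; lra | unfold A; lra]. }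
  lra.
Qed.

Lemma ccont_nonzero f z : ccont f z -> f z <> 0%C ->
  exists d, 0 < d /\ forall w, Cmod (w - z) < d -> f w <> 0%C.
Proof.
  intros Hf hz. destruct (Hf (Cmod (f z)) (Cmod_pos _ hz)) as [d [hd H]].
  exists d. split; auto. intros w hw E. specialize (H w hw).
  rewrite E, Cmod_minus_sym in H. replace (f z - 0)%C with (f z) in H by ring. lra.
Qed.

Lemma ccont_inv f z : ccont f z -> f z <> 0%C -> ccont (fun w => / f w)%C z.
Proof.
  intros Hf hz eps he. assert (hp := Cmod_pos _ hz).
  destruct (Hf (Rmin (Cmod (f z) / 2) (eps * (Cmod (f z)) ^ 2 / 2))) as [d [hd H]].
  { apply Rmin_pos; [lra|]. apply Rdiv_lt_0_compat; [|lra].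
    apply Rmult_lt_0_compat; [lra | apply pow_lt; lra]. }
  exists d. split; auto. intros w hw. specialize (H w hw). rewrite Cmod_minus_sym in H.
  assert (b1 := Rmin_l (Cmod (f z) / 2) (eps * (Cmod (f z)) ^ 2 / 2)).
  assert (b2 := Rmin_r (Cmod (f z) / 2) (eps * (Cmod (f z)) ^ 2 / 2)).
  assert (h := Cmod_triangle_inv (f z) (f w)).
  assert (hwp : 0 < Cmod (f w)) by lra.
  assert (hw0 : f w <> 0%C) by now apply Cmod_gt_0.
  replace (/ f w - / f z)%C with ((f z - f w) / (f w * f z))%C by (field; auto).
  rewrite Cmod_div, Cmod_mult by (apply Cmult_neq_0; auto).

  assert (hP : 0 < Cmod (f w) * Cmod (f z)) by now apply Rmult_lt_0_compat.
  apply Rmult_lt_reg_r with (Cmod (f w) * Cmod (f z)); [exact hP|].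
  unfold Rdiv. rewrite Rmult_assoc, Rinv_l by lra.
  assert (hd2 : Cmod (f z) / 2 <= Cmod (f w)) by lra.
  assert (eps * (Cmod (f z) / 2 * Cmod (f z)) <= eps * (Cmod (f w) * Cmod (f z))).
  { apply Rmult_le_compat_l; [lra|]. apply Rmult_le_compat_r; lra. }
  nra.
Qed.

Lemma cderiv_cont f z l : cderiv f z l -> ccont f z.
Proof.
  intros [p [hp [_ [d [hd H]]]]].
  apply (ccont_ext_loc (fun w => f z + p w * (w - z))%C f z d hd).
  - intros w hw. symmetry. auto.
  - apply ccont_plus; [apply ccont_const|]. apply ccont_mult; [exact hp|].
    apply ccont_plus; [apply ccont_id | apply ccont_const].
Qed.

Lemma cderiv_ext_loc f g z l d : 0 < d ->
  (forall w, Cmod (w - z) < d -> f w = g w) -> cderiv f z l -> cderiv g z l.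
Proof.
  intros hd E [p [hp [hl [d' [hd' H]]]]]. exists p. repeat split; auto.
  exists (Rmin d d'). split; [now apply Rmin_pos|]. intros w hw.
  assert (h1 := Rmin_l d d'). assert (h2 := Rmin_r d d').
  rewrite <- (E w), <- (E z); [apply H; lra | rewrite Cmod_minus_diag; lra | lra].
Qed.

Lemma cderiv_const c z : cderiv (fun _ => c) z 0.
Proof.
  exists (fun _ => 0%C). repeat split; auto using ccont_const.
  exists 1. split; [lra|]. intros. ring.
Qed.

Lemma cderiv_id z : cderiv (fun w => w) z 1.
Proof.
  exists (fun _ => 1%C). repeat split; auto using ccont_const.
  exists 1. split; [lra|]. intros. ring.
Qed.

Lemma cderiv_plus f g z l m :
  cderiv f z l -> cderiv g z m -> cderiv (fun w => f w + g w)%C z (l + m)%C.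
Proof.
  intros [p [hp [hl [d [hd H]]]]] [q [hq [hm [e [he H']]]]].
  exists (fun w => p w + q w)%C. repeat split; [now apply ccont_plus | congruence |].
  exists (Rmin d e). split; [now apply Rmin_pos|]. intros w hw.
  assert (h1 := Rmin_l d e). assert (h2 := Rmin_r d e).
  rewrite (H w), (H' w) by lra. ring.
Qed.

Lemma cderiv_mult f g z l m : cderiv f z l -> cderiv g z m ->
  cderiv (fun w => f w * g w)%C z (l * g z + f z * m)%C.
Proof.
  intros Hf Hg. assert (cg := cderiv_cont _ _ _ Hg).
  destruct Hf as [p [hp [hl [d [hd H]]]]]. destruct Hg as [q [hq [hm [e [he H']]]]].
  exists (fun w => p w * g w + f z * q w)%C. repeat split.
  - apply ccont_plus; apply ccont_mult; auto using ccont_const.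
  - congruence.
  - exists (Rmin d e). split; [now apply Rmin_pos|]. intros w hw.
    assert (h1 := Rmin_l d e). assert (h2 := Rmin_r d e).
    rewrite (H w) by lra.
    transitivity (f z * g w + p w * g w * (w - z))%C; [ring|].
    rewrite (H' w) at 1 by lra. ring.
Qed.

Lemma cderiv_comp f g z l m : cderiv f z l -> cderiv g (f z) m ->
  cderiv (fun w => g (f w)) z (m * l)%C.
Proof.
  intros Hf Hg. assert (cf := cderiv_cont _ _ _ Hf).
  destruct Hf as [p [hp [hl [d [hd H]]]]]. destruct Hg as [q [hq [hm [e [he H']]]]].
  exists (fun w => q (f w) * p w)%C. repeat split.
  - apply ccont_mult; auto. now apply ccont_comp.
  - congruence.
  - destruct (cf e he) as [e' [he' He']].
    exists (Rmin d e'). split; [now apply Rmin_pos|]. intros w hw.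
    assert (h1 := Rmin_l d e'). assert (h2 := Rmin_r d e').
    rewrite (H' (f w)) by (apply He'; lra).
    assert (E := H w ltac:(lra)).
    replace (f w - f z)%C with (p w * (w - z))%C; [ring|]. rewrite E at 1. ring.
Qed.

Lemma cderiv_inv f z l : cderiv f z l -> f z <> 0%C ->
  cderiv (fun w => / f w)%C z (- l / (f z * f z))%C.
Proof.
  intros Hf hz. assert (cf := cderiv_cont _ _ _ Hf).
  destruct (ccont_nonzero _ _ cf hz) as [e [he He]].
  destruct Hf as [p [hp [hl [d [hd H]]]]].
  exists (fun w => - p w * / (f w * f z))%C. repeat split.
  - apply ccont_mult; [now apply ccont_opp|]. apply ccont_inv.
    + apply ccont_mult; auto using ccont_const.
    + apply Cmult_neq_0; auto.
  - rewrite hl. reflexivity.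
  - exists (Rmin d e). split; [now apply Rmin_pos|]. intros w hw.
    assert (h1 := Rmin_l d e). assert (h2 := Rmin_r d e).
    assert (hw0 := He w ltac:(lra)). assert (E := H w ltac:(lra)).
    transitivity (/ f z - (p w * (w - z)) / (f w * f z))%C; [|unfold Cdiv; ring].
    replace (p w * (w - z))%C with (f w - f z)%C; [field; auto|]. rewrite E. ring.
Qed.

(** Continuity of the derivative near the point is part of the notion: it allows differentiation
    under the integral over a circle without Goursat's theorem. *)
Definition holo_at (f : C -> C) (z : C) : Prop :=
  exists f' d, 0 < d /\
    forall w, Cmod (w - z) < d -> cderiv f w (f' w) /\ ccont f' w.

Lemma holo_at_cont f z : holo_at f z -> ccont f z.
Proof.
  intros [f' [d [hd H]]]. destruct (H z) as [h _]; [rewrite Cmod_minus_diag; lra|].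
  exact (cderiv_cont _ _ _ h).
Qed.

Lemma holo_at_const c z : holo_at (fun _ => c) z.
Proof. exists (fun _ => 0%C), 1. split; [lra|]. auto using cderiv_const, ccont_const. Qed.

Lemma holo_at_id z : holo_at (fun w => w) z.
Proof. exists (fun _ => 1%C), 1. split; [lra|]. auto using cderiv_id, ccont_const. Qed.

Lemma holo_at_plus f g z :
  holo_at f z -> holo_at g z -> holo_at (fun w => f w + g w)%C z.
Proof.
  intros [f' [d [hd H]]] [g' [e [he H']]].
  exists (fun w => f' w + g' w)%C, (Rmin d e). split; [now apply Rmin_pos|]. intros w hw.
  assert (h1 := Rmin_l d e). assert (h2 := Rmin_r d e).
  destruct (H w) as [a b]; [lra|]. destruct (H' w) as [a' b']; [lra|].
  split; [now apply cderiv_plus | now apply ccont_plus].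
Qed.

Lemma holo_at_mult f g z :
  holo_at f z -> holo_at g z -> holo_at (fun w => f w * g w)%C z.
Proof.
  intros [f' [d [hd H]]] [g' [e [he H']]].
  exists (fun w => f' w * g w + f w * g' w)%C, (Rmin d e).
  split; [now apply Rmin_pos|]. intros w hw.
  assert (h1 := Rmin_l d e). assert (h2 := Rmin_r d e).
  destruct (H w) as [a b]; [lra|]. destruct (H' w) as [a' b']; [lra|].
  split; [now apply cderiv_mult|].
  apply ccont_plus; apply ccont_mult; auto; eapply cderiv_cont; eauto.
Qed.

Lemma Cmod_lt_margin z w r : Cmod (w - z) < r ->
  exists d, 0 < d /\ forall v, Cmod (v - w) < d -> Cmod (v - z) < r.
Proof.
  intros h. exists (r - Cmod (w - z)). split; [lra|]. intros v hv.
  assert (H := Cmod_triang_minus v w z). lra.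
Qed.

Lemma holo_at_comp f g z :
  holo_at f z -> holo_at g (f z) -> holo_at (fun w => g (f w)) z.
Proof.
  intros Hf [g' [e [he H']]]. assert (cf := holo_at_cont _ _ Hf).
  destruct Hf as [f' [d [hd H]]]. destruct (cf e he) as [e' [he' He']].
  exists (fun w => g' (f w) * f' w)%C, (Rmin d e').
  split; [now apply Rmin_pos|]. intros w hw.
  assert (h1 := Rmin_l d e'). assert (h2 := Rmin_r d e').
  destruct (H w) as [a b]; [lra|]. destruct (H' (f w)) as [a' b']; [apply He'; lra|].
  split; [now apply cderiv_comp|].
  apply ccont_mult; auto. apply ccont_comp; auto. eapply cderiv_cont; eauto.
Qed.

Lemma holo_at_inv f z : holo_at f z -> f z <> 0%C -> holo_at (fun w => / f w)%C z.
Proof.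
  intros Hf hz. assert (cf := holo_at_cont _ _ Hf).
  destruct (ccont_nonzero _ _ cf hz) as [e [he He]].
  destruct Hf as [f' [d [hd H]]].
  exists (fun w => - f' w / (f w * f w))%C, (Rmin d e).
  split; [now apply Rmin_pos|]. intros w hw.
  assert (h1 := Rmin_l d e). assert (h2 := Rmin_r d e).
  destruct (H w) as [a b]; [lra|]. assert (hw0 := He w ltac:(lra)).
  split; [now apply cderiv_inv|].
  assert (cw := cderiv_cont _ _ _ a).
  apply ccont_mult; [now apply ccont_opp|]. apply ccont_inv; [now apply ccont_mult|].
  apply Cmult_neq_0; auto.
Qed.

Lemma holo_at_ext_loc f g z d : 0 < d ->
  (forall w, Cmod (w - z) < d -> f w = g w) -> holo_at f z -> holo_at g z.
Proof.
  intros hd E [f' [e [he H]]]. exists f', (Rmin d e).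
  split; [now apply Rmin_pos|]. intros w hw.
  assert (h1 := Rmin_l d e). assert (h2 := Rmin_r d e).
  destruct (H w) as [a b]; [lra|]. split; auto.
  destruct (Cmod_lt_margin z w d) as [k [hk Hk]]; [lra|].
  apply (cderiv_ext_loc f g w _ k hk); auto.
Qed.

(** * Real differentials of complex differentiable functions *)

Lemma cderiv_differentiable f z l : cderiv f z l ->
  differentiable_pt_lim (fun x y => fst (f (x, y))) (fst z) (snd z) (fst l) (- snd l) /\
  differentiable_pt_lim (fun x y => snd (f (x, y))) (fst z) (snd z) (snd l) (fst l).
Proof.
  intros [p [hp [hl [d [hd H]]]]].
  assert (key : forall eps : posreal, locally_2d (fun u v =>
     Cmod (f (u, v) - f z - l * ((u, v) - z))%C
       <= eps * Rmax (Rabs (u - fst z)) (Rabs (v - snd z))) (fst z) (snd z)).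
  { intros eps. destruct (hp (eps / 2)) as [e [he He]].
    { generalize (cond_pos eps); lra. }
    assert (hm : 0 < Rmin d e / 2) by (generalize (Rmin_pos d e hd he); lra).
    exists (mkposreal _ hm). simpl. intros u v hu hv.
    assert (h1 := Rmin_l d e). assert (h2 := Rmin_r d e).
    assert (hle := Cmod_le_abs ((u, v) - z)). simpl in hle.
    change (u + - fst z) with (u - fst z) in hle.
    change (v + - snd z) with (v - snd z) in hle.
    rewrite (H (u, v)) by lra.
    replace (f z + p (u, v) * ((u, v) - z) - f z - l * ((u, v) - z))%C
      with ((p (u, v) - p z) * ((u, v) - z))%C by (rewrite hl; ring).
    rewrite Cmod_mult. specialize (He (u, v) ltac:(lra)).
    assert (m1 := Rmax_l (Rabs (u - fst z)) (Rabs (v - snd z))).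
    assert (m2 := Rmax_r (Rabs (u - fst z)) (Rabs (v - snd z))).
    assert (q1 := Cmod_ge_0 (p (u, v) - p z)). assert (q2 := Cmod_ge_0 ((u, v) - z)).
    apply Rle_trans with (eps / 2 * (2 * Rmax (Rabs (u - fst z)) (Rabs (v - snd z)))).
    - apply Rmult_le_compat; lra.
    - right. field. }
  split; intros eps; generalize (key eps); apply locally_2d_impl;
    apply locally_2d_forall; intros u v hle; refine (Rle_trans _ _ _ _ hle).
  - refine (Rle_trans _ _ _ _ (fst_le_Cmod _)). right. f_equal.
    rewrite <- surjective_pairing. simpl. ring.
  - refine (Rle_trans _ _ _ _ (snd_le_Cmod _)). right. f_equal.
    rewrite <- surjective_pairing. simpl. ring.
Qed.

(** The chain rule along a real curve, used below for rays and circles, for segments and for the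
    coordinate directions. *)
Lemma cderiv_curve f (x y : R -> R) t x' y' l :
  cderiv f (x t, y t) l -> is_derive x t x' -> is_derive y t y' ->
  is_derive (fun s => fst (f (x s, y s))) t (fst (l * (x', y'))%C) /\
  is_derive (fun s => snd (f (x s, y s))) t (snd (l * (x', y'))%C).
Proof.
  intros H hx hy. apply cderiv_differentiable in H as [H1 H2]. simpl in H1, H2.
  apply is_derive_Reals in hx. apply is_derive_Reals in hy.
  split; apply is_derive_Reals.
  - replace (fst (l * (x', y'))%C) with (fst l * x' + - snd l * y') by (simpl; ring).
    exact (derivable_pt_lim_comp_2d _ _ _ _ _ _ _ _ H1 hx hy).
  - replace (snd (l * (x', y'))%C) with (snd l * x' + fst l * y') by (simpl; ring).
    exact (derivable_pt_lim_comp_2d _ _ _ _ _ _ _ _ H2 hx hy).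
Qed.

Lemma ccont_2d f z : ccont f z ->
  continuity_2d_pt (fun x y => fst (f (x, y))) (fst z) (snd z) /\
  continuity_2d_pt (fun x y => snd (f (x, y))) (fst z) (snd z).
Proof.
  intros H. assert (key : forall eps : posreal, locally_2d (fun u v =>
     Cmod (f (u, v) - f z)%C < eps) (fst z) (snd z)).
  { intros eps. destruct (H eps (cond_pos eps)) as [d [hd Hd]].
    assert (hm : 0 < d / 2) by lra. exists (mkposreal _ hm). simpl. intros u v hu hv.
    apply Hd. assert (hle := Cmod_le_abs ((u, v) - z)). simpl in hle.
    change (u + - fst z) with (u - fst z) in hle.
    change (v + - snd z) with (v - snd z) in hle. lra. }
  split; intros eps; generalize (key eps); apply locally_2d_impl;
    apply locally_2d_forall; intros u v hle; refine (Rle_lt_trans _ _ _ _ hle);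
    rewrite <- surjective_pairing.
  - exact (fst_le_Cmod (f (u, v) - f z)).
  - exact (snd_le_Cmod (f (u, v) - f z)).
Qed.

(** * The mean value property on circles *)

Lemma continuity_2d_pt_comp_2d (f g h : R -> R -> R) x y :
  continuity_2d_pt f (g x y) (h x y) -> continuity_2d_pt g x y ->
  continuity_2d_pt h x y -> continuity_2d_pt (fun u v => f (g u v) (h u v)) x y.
Proof.
  intros Hf Hg Hh eps. destruct (Hf eps) as [d Hd].
  destruct (Hg d) as [d1 H1]. destruct (Hh d) as [d2 H2].
  exists (mkposreal _ (Rmin_pos _ _ (cond_pos d1) (cond_pos d2))). simpl.
  intros u v hu hv. assert (h1 := Rmin_l d1 d2). assert (h2 := Rmin_r d1 d2).
  apply Hd; [apply H1 | apply H2]; lra.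
Qed.

Definition polar (r t : R) : C := (r * cos t, r * sin t).

Lemma Cmod_polar r t : 0 <= r -> Cmod (polar r t) = r.
Proof.
  intros hr. unfold Cmod, polar; simpl fst; simpl snd.
  assert (H := sin2_cos2 t). unfold Rsqr in H.
  replace ((r * cos t) ^ 2 + (r * sin t) ^ 2) with (r ^ 2) by nra.
  now apply sqrt_pow2.
Qed.

Lemma polar_cont r t :
  continuity_2d_pt (fun r t => fst (polar r t)) r t /\
  continuity_2d_pt (fun r t => snd (polar r t)) r t.
Proof.
  split; simpl; apply continuity_2d_pt_mult; try apply continuity_2d_pt_id1;
  apply (continuity_1d_2d_pt_comp _ (fun _ v => v)); try apply continuity_2d_pt_id2.
  - apply continuity_cos.
  - apply continuity_sin.
Qed.

Lemma polar_near r t d : 0 < d ->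
  locally_2d (fun u v => Cmod (polar u v - polar r t) < d) r t.
Proof.
  intros hd. destruct (polar_cont r t) as [h1 h2].
  assert (hp : 0 < d / 2) by lra.
  generalize (locally_2d_and _ _ _ _ (h1 (mkposreal _ hp)) (h2 (mkposreal _ hp))).
  apply locally_2d_impl, locally_2d_forall. intros u v [a b].
  eapply Rle_lt_trans; [apply Cmod_le_abs|]. simpl in *. unfold Rminus in *. lra.
Qed.

Lemma ccont_polar u r t : ccont u (polar r t) ->
  continuity_2d_pt (fun r t => fst (u (polar r t))) r t.
Proof.
  intros H. destruct (ccont_2d _ _ H) as [h _]. destruct (polar_cont r t).
  exact (continuity_2d_pt_comp_2d (fun x y => fst (u (x, y))) _ _ r t h H0 H1).
Qed.

Lemma ccont_polar_angle u r t : ccont u (polar r t) ->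
  continuous (fun t => fst (u (polar r t))) t.
Proof.
  intros H. apply continuity_pt_filterlim. intros eps he.
  destruct (ccont_polar _ _ _ H (mkposreal _ he)) as [d Hd].
  exists d. split; [apply cond_pos|]. intros v [_ hv].
  apply (Hd r v); [|exact hv]. replace (r - r) with 0 by ring.
  rewrite Rabs_R0. apply cond_pos.
Qed.

(** Cauchy-Riemann in polar form: the tangent to the circle is [Ci * r] times the radial direction,
    so both derivatives involve the same number. *)
Lemma cderiv_polar u r t l : cderiv u (polar r t) l ->
  is_derive (fun r => fst (u (polar r t))) r (fst (l * polar 1 t)%C) /\
  is_derive (fun t => snd (u (polar r t))) t (r * fst (l * polar 1 t)%C).
Proof.
  intros H. split.
  - replace (fst (l * polar 1 t)%C) with (fst (l * (cos t, sin t))%C) by (simpl; ring).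
    refine (proj1 (cderiv_curve u (fun r => r * cos t) (fun r => r * sin t)
              r _ _ l H _ _)); auto_derive; auto; ring.
  - replace (r * fst (l * polar 1 t)%C)
      with (snd (l * (- (r * sin t), r * cos t)%R)%C) by (simpl; ring).
    refine (proj2 (cderiv_curve u (fun t => r * cos t) (fun t => r * sin t)
              t _ _ l H _ _)); auto_derive; auto; ring.
Qed.

Lemma holo_polar_Derive_cont u r t : holo_at u (polar r t) ->
  continuity_2d_pt (fun r t => Derive (fun s => fst (u (polar s t))) r) r t.
Proof.
  intros [u' [d [hd H]]].
  apply continuity_2d_pt_ext_loc with
    (fun r t => fst ((fun z => u' z) (polar r t)) * fst (polar 1 t)
                - snd ((fun z => u' z) (polar r t)) * snd (polar 1 t)).
  - generalize (polar_near r t d hd). apply locally_2d_impl, locally_2d_forall.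
    intros v w h. symmetry. apply is_derive_unique.
    exact (proj1 (cderiv_polar u v w _ (proj1 (H _ h)))).
  - destruct (H (polar r t)) as [_ hc]; [rewrite Cmod_minus_diag; lra|].
    destruct (ccont_2d _ _ hc) as [h1 h2]. destruct (polar_cont r t) as [p1 p2].
    destruct (polar_cont 1 t) as [q1 q2].
    apply continuity_2d_pt_minus; apply continuity_2d_pt_mult.
    + exact (continuity_2d_pt_comp_2d _ _ _ r t h1 p1 p2).
    + refine (continuity_2d_pt_comp_2d _ (fun _ _ => 1) (fun _ v => v) r t q1 _ _).
      * apply continuity_2d_pt_const.
      * apply continuity_2d_pt_id2.
    + exact (continuity_2d_pt_comp_2d _ _ _ r t h2 p1 p2).
    + refine (continuity_2d_pt_comp_2d _ (fun _ _ => 1) (fun _ v => v) r t q2 _ _).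
      * apply continuity_2d_pt_const.
      * apply continuity_2d_pt_id2.
Qed.

Definition circle_int (u : C -> C) (r : R) : R :=
  RInt (fun t => fst (u (polar r t))) 0 (2 * PI).

Lemma circle_ex_RInt u r : (forall t, ccont u (polar r t)) ->
  ex_RInt (fun t => fst (u (polar r t))) 0 (2 * PI).
Proof. intros H. apply @ex_RInt_continuous. intros t _. now apply ccont_polar_angle. Qed.

Lemma circle_int_cont u r :
  (exists d, 0 < d /\ forall s t, Rabs (s - r) < d -> ccont u (polar s t)) ->
  continuity_pt (circle_int u) r.
Proof.
  intros [d [hd H]] eps he. assert (hpi := PI_RGT_0).
  assert (hr : forall t, ccont u (polar r t)).
  { intros t. apply H. replace (r - r) with 0 by ring. rewrite Rabs_R0. lra. }
  assert (hp : 0 < eps / (4 * PI)) by (apply Rdiv_lt_0_compat; lra).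
  destruct (uniform_continuity_2d_1d' (fun r t => fst (u (polar r t))) 0 (2 * PI) r)
    with (mkposreal _ hp) as [e He].
  { intros t _. now apply ccont_polar. }
  simpl in He. exists (Rmin d e). split; [apply Rmin_pos; [lra | apply cond_pos]|].
  intros s [_ hs]. simpl in hs. unfold R_dist in *.
  assert (h1 := Rmin_l d e). assert (h2 := Rmin_r d e).
  assert (hse := Rabs_def2 _ _ hs).
  assert (hcs : forall t, ccont u (polar s t)) by (intros t; apply H; lra).
  change (Rabs (circle_int u s - circle_int u r) < eps). unfold circle_int.
  assert (E := RInt_minus (V := R_CompleteNormedModule) _ _ 0 (2 * PI) (circle_ex_RInt u s hcs) (circle_ex_RInt u r hr)).
  unfold minus, plus, opp in E; simpl in E. unfold Rminus. rewrite <- E.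
  apply Rle_lt_trans with ((2 * PI - 0) * (eps / (4 * PI))).
  - apply abs_RInt_le_const; [lra | |].
    + apply @ex_RInt_continuous. intros t _.
      apply (continuous_minus (V := R_NormedModule)); now apply ccont_polar_angle.
    + intros t ht. left. apply (He t r t s); try lra.
      replace (t - t) with 0 by ring. rewrite Rabs_R0. apply cond_pos.
  - replace ((2 * PI - 0) * (eps / (4 * PI))) with (eps / 2) by (field; lra). lra.
Qed.

(* By Cauchy-Riemann the radial derivative of [Re u] is, up to the factor [r],
   the angular derivative of [Im u], whose integral over the circle vanishes. *)
Lemma circle_int_derive u r : 0 < r ->
  (exists d, 0 < d /\ forall s t, Rabs (s - r) < d -> holo_at u (polar s t)) ->
  is_derive (circle_int u) r 0.
Proof.
  intros hr0 [d [hd H]].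
  assert (hr : forall t, holo_at u (polar r t)).
  { intros t. apply H. replace (r - r) with 0 by ring. rewrite Rabs_R0. lra. }
  assert (hder : forall s t, Rabs (s - r) < d ->
    is_derive (fun s => fst (u (polar s t))) s
      (Derive (fun s => fst (u (polar s t))) s) /\
    is_derive (fun t => snd (u (polar s t))) t
      (s * Derive (fun s => fst (u (polar s t))) s)).
  { intros s t hs. destruct (H s t hs) as [u' [e [he He]]].
    destruct (He (polar s t)) as [hc _]; [rewrite Cmod_minus_diag; lra|].
    destruct (cderiv_polar u s t _ hc) as [a b].
    assert (E : Derive (fun s => fst (u (polar s t))) s
                = fst (u' (polar s t) * polar 1 t)%C) by exact (is_derive_unique _ _ _ a).
    now rewrite E. }
  assert (hl : locally r (fun s => Rabs (s - r) < d)).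
  { exists (mkposreal d hd). intros s hs. exact hs. }
  replace 0 with (RInt (fun t => Derive (fun s => fst (u (polar s t))) r) 0 (2 * PI)).
  - apply (is_derive_RInt_param (fun s t => fst (u (polar s t)))).
    + refine (filter_imp _ _ _ hl). intros s hs t _. eexists. exact (proj1 (hder s t hs)).
    + intros t _. now apply holo_polar_Derive_cont.
    + refine (filter_imp _ _ _ hl). intros s hs. apply circle_ex_RInt.
      intros t. apply holo_at_cont. auto.
  - assert (hrr : Rabs (r - r) < d).
    { replace (r - r) with 0 by ring. rewrite Rabs_R0. lra. }
    apply is_RInt_unique.
    assert (hi := is_RInt_derive (fun t => / r * snd (u (polar r t)))
      (fun t => Derive (fun s => fst (u (polar s t))) r) 0 (2 * PI)).
    replace 0 with (minus (/ r * snd (u (polar r (2 * PI)))) (/ r * snd (u (polar r 0)))) at 2.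
    apply hi.
    + intros t _. apply is_derive_ext with (fun t => scal (/ r) (snd (u (polar r t)))); auto.
      replace (Derive (fun s => fst (u (polar s t))) r) with
        (scal (/ r) (r * Derive (fun s => fst (u (polar s t))) r)).
      * apply is_derive_scal. exact (proj2 (hder r t hrr)).
      * unfold scal; simpl; unfold mult; simpl. field. lra.
    + intros t _. apply continuity_pt_filterlim. intros eps he.
      destruct (holo_polar_Derive_cont _ _ _ (hr t) (mkposreal _ he)) as [e He].
      exists e. split; [apply cond_pos|]. intros v [_ hv].
      apply (He r v); [|exact hv]. replace (r - r) with 0 by ring.
      rewrite Rabs_R0. apply cond_pos.
    + replace (polar r (2 * PI)) with (polar r 0).
      * unfold minus, plus, opp; simpl. ring.
      * unfold polar. now rewrite cos_2PI, sin_2PI, cos_0, sin_0.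
Qed.

Lemma constant_of_derive_0 (f : R -> R) a b : a <= b ->
  (forall x, a <= x <= b -> continuity_pt f x) ->
  (forall x, a < x < b -> is_derive f x 0) -> f b = f a.
Proof.
  intros hab hc hd.
  destruct (MVT_gen f a b (fun _ => 0)) as [c [_ E]].
  - intros x hx. rewrite Rmin_left, Rmax_right in hx by auto. auto.
  - intros x hx. rewrite Rmin_left, Rmax_right in hx by auto. auto.
  - lra.
Qed.

(** One exceptional point [b], where [u] is merely continuous, is allowed, so that the quotient in
    the Schwarz lemma needs no theorem on removable singularities. The circle integral has zero
    derivative except perhaps at the radius [Cmod b], and continuity carries its value across that
    radius and down to 0. *)
Lemma circle_mean_le u b S t :
  (forall z, Cmod z < 1 -> ccont u z) ->
  (forall z, Cmod z < 1 -> z <> b -> holo_at u z) ->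
  0 < t < 1 -> (forall z, Cmod z = t -> fst (u z) <= S) -> fst (u 0) <= S.
Proof.
  intros hc hh ht hS. assert (hpi := PI_RGT_0).
  assert (cont0 : continuity_pt (circle_int u) 0).
  { apply circle_int_cont.
    exists 1. split; [lra|]. intros s v hs. apply hc.
    rewrite Rminus_0_r in hs. unfold polar.
    (* Continuity at radius 0 is two-sided, so negative radii occur; they describe the same circles
       with the angle shifted by half a turn. *)
    destruct (Rle_dec 0 s) as [h|h].
    - fold (polar s v). rewrite Cmod_polar; [|auto]. rewrite Rabs_right in hs; lra.
    - replace (s * cos v, s * sin v) with (- polar (- s) v)%C.
      + rewrite Cmod_opp, Cmod_polar by lra. rewrite Rabs_left in hs; lra.
      + unfold polar. unfold Copp; simpl. f_equal; ring. }
  assert (cont : forall s, 0 <= s < 1 -> continuity_pt (circle_int u) s).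
  { intros s [[hs|<-] hs1]; [|exact cont0]. apply circle_int_cont.
    assert (hm : 0 < Rmin s (1 - s)) by (apply Rmin_pos; lra).
    exists (Rmin s (1 - s)). split; [auto|]. intros r v hr. apply Rabs_def2 in hr.
    assert (h1 := Rmin_l s (1 - s)). assert (h2 := Rmin_r s (1 - s)).
    apply hc. rewrite Cmod_polar; lra. }
  assert (der : forall s, 0 < s < 1 -> s <> Cmod b -> is_derive (circle_int u) s 0).
  { intros s hs hb. apply circle_int_derive; [lra|].
    set (e := Rmin (Rmin s (1 - s)) (Rabs (s - Cmod b))).
    assert (hm : 0 < e).
    { apply Rmin_pos; [apply Rmin_pos; lra|]. apply Rabs_pos_lt. lra. }
    assert (h1 := Rmin_l s (1 - s)). assert (h2 := Rmin_r s (1 - s)).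
    assert (h3 := Rmin_l (Rmin s (1 - s)) (Rabs (s - Cmod b))).
    assert (h4 := Rmin_r (Rmin s (1 - s)) (Rabs (s - Cmod b))).
    fold e in h3, h4.
    exists e. split; [auto|]. intros r v hr. assert (hr' := Rabs_def2 _ _ hr).
    apply hh; [rewrite Cmod_polar; lra|]. intros E.
    assert (E' : r = Cmod b) by (rewrite <- E, Cmod_polar; lra).
    rewrite E' in hr. rewrite Rabs_minus_sym in hr. lra. }
  assert (E : circle_int u t = circle_int u 0).
  { destruct (Rle_lt_dec t (Cmod b)) as [h|h].
    - apply constant_of_derive_0; [lra | |].
      + intros x hx. apply cont. lra.
      + intros x hx. apply der; lra.
    - assert (hb := Cmod_ge_0 b). transitivity (circle_int u (Cmod b)).
      + apply constant_of_derive_0; [lra | |].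
        * intros x hx. apply cont. lra.
        * intros x hx. apply der; lra.
      + apply constant_of_derive_0; [lra | |].
        * intros x hx. apply cont. lra.
        * intros x hx. apply der; lra. }
  assert (E0 : circle_int u 0 = 2 * PI * fst (u 0)).
  { unfold circle_int. transitivity (RInt (fun _ => fst (u 0)) 0 (2 * PI)).
    - apply RInt_ext. intros x _. unfold polar. now rewrite !Rmult_0_l.
    - rewrite RInt_const. unfold scal; simpl; unfold mult; simpl. ring. }
  assert (Et : circle_int u t <= 2 * PI * S).
  { unfold circle_int. replace (2 * PI * S) with (RInt (fun _ : R => S) 0 (2 * PI)).
    - apply RInt_le; [lra | | apply ex_RInt_const |].
      + apply circle_ex_RInt. intros v. apply hc. rewrite Cmod_polar; lra.
      + intros x _. apply hS. apply Cmod_polar; lra.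
    - rewrite RInt_const. unfold scal; simpl; unfold mult; simpl. ring. }
  apply Rmult_le_reg_l with (2 * PI); lra.
Qed.

(** Multiplying [u] by the constant [Cconj (u 0)] makes its value at 0 real and equal to |u(0)|^2,
    which reduces moduli to real parts. *)
Lemma circle_max u b S t :
  (forall z, Cmod z < 1 -> ccont u z) ->
  (forall z, Cmod z < 1 -> z <> b -> holo_at u z) ->
  0 < t < 1 -> (forall z, Cmod z = t -> Cmod (u z) <= S) -> Cmod (u 0) <= S.
Proof.
  intros hc hh ht hS.
  destruct (Ceq_dec (u 0) 0) as [E|hn].
  - rewrite E, Cmod_0. refine (Rle_trans _ _ _ (Cmod_ge_0 _) (hS (polar t 0) _)).
    apply Cmod_polar. lra.
  - assert (hp := Cmod_pos _ hn).
    assert (H := circle_mean_le (fun z => Cconj (u 0) * u z)%C b (Cmod (u 0) * S) t).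
    assert (E : fst (Cconj (u 0) * u 0)%C = Cmod (u 0) * Cmod (u 0)).
    { replace (Cmod (u 0) * Cmod (u 0)) with (Cmod (u 0) ^ 2) by ring.
      rewrite Cmod_sqr. simpl. ring. }
    apply Rmult_le_reg_l with (Cmod (u 0)); [exact hp|].
    rewrite <- E. apply H; auto.
    + intros z hz. apply ccont_mult; auto using ccont_const.
    + intros z hz hb. apply holo_at_mult; auto using holo_at_const.
    + intros z hz. refine (Rle_trans _ _ _ (Rle_abs _) _).
      refine (Rle_trans _ _ _ (fst_le_Cmod _) _). rewrite Cmod_mult, Cmod_conj.
      apply Rmult_le_compat_l; [lra | auto].
Qed.

(** * Moebius maps and the Schwarz lemma *)

Definition mobius (a z : C) : C := ((z + a) * / (1 + Cconj a * z))%C.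

Lemma mobius_den a z : Cmod a < 1 -> Cmod z <= 1 -> (1 + Cconj a * z)%C <> 0%C.
Proof.
  intros ha hz E. assert (H := Cmod_triangle_inv 1 (- (Cconj a * z))).
  replace (1 - - (Cconj a * z))%C with (1 + Cconj a * z)%C in H by ring.
  rewrite E, Cmod_opp, Cmod_0, Cmod_1, Cmod_mult, Cmod_conj in H.
  assert (h1 := Cmod_ge_0 a). assert (h2 := Cmod_ge_0 z). nra.
Qed.

Lemma mobius_0 a : mobius a 0 = a.
Proof. unfold mobius. replace (1 + Cconj a * 0)%C with (RtoC 1) by ring. field. Qed.

(** The source of all size estimates for Moebius maps: invariance of the disk, behaviour near the
    circle and the conformal factor of the chart. *)
Lemma one_minus_mobius a z : Cmod a < 1 -> Cmod z <= 1 ->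
  1 - Cmod (mobius a z) ^ 2 =
  (1 - Cmod a ^ 2) * (1 - Cmod z ^ 2) / Cmod (1 + Cconj a * z) ^ 2.
Proof.
  intros ha hz. assert (hd := mobius_den a z ha hz).
  assert (hp := Cmod_pos _ hd). unfold mobius.
  rewrite Cmod_mult, Cmod_inv by exact hd.
  assert (E : Cmod (1 + Cconj a * z) ^ 2 - Cmod (z + a) ^ 2
    = (1 - Cmod a ^ 2) * (1 - Cmod z ^ 2)) by (rewrite !Cmod_sqr; simpl; ring).
  rewrite <- E. field. lra.
Qed.

Lemma mobius_lt_1 a z : Cmod a < 1 -> Cmod z < 1 -> Cmod (mobius a z) < 1.
Proof.
  intros ha hz. assert (H := one_minus_mobius a z ha ltac:(lra)).
  assert (hp := Cmod_pos _ (mobius_den a z ha ltac:(lra))).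
  assert (h1 := Cmod_ge_0 a). assert (h2 := Cmod_ge_0 z).
  assert (0 < 1 - Cmod (mobius a z) ^ 2).
  { rewrite H. apply Rdiv_lt_0_compat; [|now apply pow_lt].
    apply Rmult_lt_0_compat; nra. }
  assert (h3 := Cmod_ge_0 (mobius a z)). nra.
Qed.

Lemma mobius_inj_zero a z : Cmod a < 1 -> Cmod z < 1 -> mobius a z = 0%C -> z = (- a)%C.
Proof.
  intros ha hz E. assert (hd := mobius_den a z ha ltac:(lra)). unfold mobius in E.
  assert (E' : ((z + a) * / (1 + Cconj a * z) * (1 + Cconj a * z))%C = 0%C)
    by (rewrite E; ring).
  rewrite <- Cmult_assoc, Cinv_l in E' by exact hd.
  replace z with ((z + a) * 1 - a)%C by ring. rewrite E'. ring.
Qed.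

Lemma Cmod2_neq1 a : Cmod a < 1 -> (1 - Cconj a * a)%C <> 0%C.
Proof.
  intros ha E. apply (mobius_den (- a) a); rewrite ?Cmod_opp; [lra | lra |].
  rewrite Copp_conj. rewrite <- E. ring.
Qed.

Lemma mobius_K a z : Cmod a < 1 -> Cmod z < 1 -> mobius (- a) (mobius a z) = z.
Proof.
  intros ha hz. assert (hd := mobius_den a z ha ltac:(lra)).
  assert (hd' := mobius_den (- a) (mobius a z)).
  rewrite Cmod_opp in hd'. specialize (hd' ha ltac:(generalize (mobius_lt_1 a z ha hz); lra)).
  unfold mobius in *. rewrite Copp_conj in *.
  assert (E : (1 + - Cconj a * ((z + a) * / (1 + Cconj a * z)))%C
     = ((1 - Cconj a * a) * / (1 + Cconj a * z))%C) by (field; exact hd).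
  rewrite E. assert (hn := Cmod2_neq1 a ha). field. split; auto.
Qed.

Lemma cderiv_mobius a z : Cmod a < 1 -> Cmod z < 1 ->
  cderiv (mobius a) z ((1 - Cconj a * a) / ((1 + Cconj a * z) * (1 + Cconj a * z)))%C.
Proof.
  intros ha hz. assert (hd := mobius_den a z ha ltac:(lra)).
  assert (h1 : cderiv (fun w => w + a)%C z (1 + 0)%C).
  { apply cderiv_plus; [apply cderiv_id | apply cderiv_const]. }
  assert (h2 : cderiv (fun w => 1 + Cconj a * w)%C z (0 + (0 * z + Cconj a * 1))%C).
  { apply cderiv_plus; [apply cderiv_const|].
    apply (cderiv_mult (fun _ => Cconj a) (fun w => w)); [apply cderiv_const | apply cderiv_id]. }
  assert (h := cderiv_mult _ _ _ _ _ h1 (cderiv_inv _ _ _ h2 hd)). simpl in h.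
  replace ((1 - Cconj a * a) / ((1 + Cconj a * z) * (1 + Cconj a * z)))%C with
   ((1 + 0) * / (1 + Cconj a * z) +
       (z + a) * (- (0 + (0 * z + Cconj a * 1)) / ((1 + Cconj a * z) * (1 + Cconj a * z))))%C
   by (field; exact hd).
  exact h.
Qed.

Lemma holo_mobius a z : Cmod a < 1 -> Cmod z < 1 -> holo_at (mobius a) z.
Proof.
  intros ha hz. apply holo_at_mult.
  - apply holo_at_plus; [apply holo_at_id | apply holo_at_const].
  - apply holo_at_inv; [|apply mobius_den; lra].
    apply holo_at_plus; [apply holo_at_const|].
    apply holo_at_mult; [apply holo_at_const | apply holo_at_id].
Qed.

(** A quantitative substitute for the fact that the map sends the unit circle to itself. *)
Lemma mobius_near_circle a s : Cmod a < 1 -> 0 < s < 1 ->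
  exists t, 0 < t < 1 /\ forall z, Cmod z = t -> s <= Cmod (mobius a z).
Proof.
  intros ha hs. assert (h0 := Cmod_ge_0 a). set (q := Cmod a) in *.
  (* With |z| = 1 - k, 1 - |mobius|^2 is at most 2 (1 - q) 2 k / (1 - q)^2 = 4 k / (1 - q), which is
     1 - s for this [k]. *)
  set (k := (1 - s) * (1 - q) / 4).
  assert (hk : 0 < k < 1) by (unfold k; nra).
  exists (1 - k). split; [lra|]. intros z hz.
  assert (E := one_minus_mobius a z ha ltac:(lra)). fold q in E. rewrite hz in E.
  assert (hd : 1 - q <= Cmod (1 + Cconj a * z)).
  { assert (H := Cmod_triangle_inv 1 (- (Cconj a * z))).
    replace (1 - - (Cconj a * z))%C with (1 + Cconj a * z)%C in H by ring.
    rewrite Cmod_opp, Cmod_1, Cmod_mult, Cmod_conj, hz in H. fold q in H. nra. }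
  set (D := Cmod (1 + Cconj a * z)) in *.
  assert (hD : (1 - q ^ 2) * (1 - (1 - k) ^ 2) / D ^ 2 <= 1 - s).
  { assert (hD2 : (1 - q) ^ 2 <= D ^ 2) by (apply pow_incr; lra).
    assert (hD0 : 0 < D ^ 2) by (apply pow_lt; lra).
    apply Rmult_le_reg_r with (D ^ 2); [exact hD0|].
    unfold Rdiv. rewrite Rmult_assoc, Rinv_l by lra.
    apply Rle_trans with ((1 - s) * (1 - q) ^ 2); [|apply Rmult_le_compat_l; lra].
    assert (1 - (1 - k) ^ 2 <= 2 * k) by nra.
    assert (0 <= 1 - q ^ 2 <= 2 * (1 - q)) by nra.
    assert (0 <= 1 - (1 - k) ^ 2) by nra.
    apply Rle_trans with ((2 * (1 - q)) * (2 * k)).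
    - rewrite Rmult_1_r. apply Rmult_le_compat; lra.
    - unfold k. right. field. }
  assert (h3 := Cmod_ge_0 (mobius a z)). nra.
Qed.

(** The maximum principle at hand only concerns circles centred at 0. It is therefore applied to
    v(z) / z composed with the Moebius map taking 0 to [a]; the exceptional point is [- a], where
    that map vanishes. *)
Theorem Schwarz_lemma v a :
  (forall z, Cmod z < 1 -> holo_at v z) -> v (RtoC 0) = RtoC 0 ->
  (forall z, Cmod z < 1 -> Cmod (v z) <= 1) ->
  Cmod a < 1 -> Cmod (v a) <= Cmod a.
Proof.
  intros hv v0 hb ha.
  destruct (Ceq_dec a 0) as [->|ha0]; [rewrite v0; lra|].
  assert (hc0 : exists p d, ccont p 0%C /\ 0 < d /\
      forall w, Cmod w < d -> v w = (p w * w)%C).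
  { destruct (hv 0%C) as [v' [d [hd H]]]; [rewrite Cmod_0; lra|].
    destruct (H 0%C) as [[p [hp [_ [e [he He]]]]] _]; [rewrite Cmod_minus_diag; lra|].
    exists p, e. repeat split; auto. intros w hw. rewrite He, v0.
    - ring.
    - now replace (w - 0)%C with w by ring. }
  destruct hc0 as [p [d [hp [hd H]]]].
  (* The value [p 0] is the derivative of [v] at 0, which makes [q] continuous there. *)
  set (q := fun z => if Ceq_dec z 0 then p 0%C else (v z * / z)%C).
  assert (qh : forall z, Cmod z < 1 -> z <> 0%C -> holo_at q z).
  { intros z hz hz0. apply holo_at_ext_loc with (fun z => v z * / z)%C (Cmod z).
    - now apply Cmod_pos.
    - intros w hw. unfold q. destruct (Ceq_dec w 0) as [->|]; auto.
      exfalso. rewrite Cmod_minus_sym in hw.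
      replace (z - 0)%C with z in hw by ring. lra.
    - apply holo_at_mult; auto. apply holo_at_inv; auto. apply holo_at_id. }
  assert (qc : forall z, Cmod z < 1 -> ccont q z).
  { intros z hz. destruct (Ceq_dec z 0) as [->|hz0]; [|now apply holo_at_cont, qh].
    apply (ccont_ext_loc p q 0%C d hd); auto. intros w hw.
    replace (w - 0)%C with w in hw by ring.
    unfold q. destruct (Ceq_dec w 0) as [->|hw0]; auto. rewrite H by auto. field. auto. }
  assert (key : forall s, 0 < s < 1 -> Cmod (q a) <= / s).
  { intros s hs. destruct (mobius_near_circle a s ha hs) as [t [ht Ht]].
    rewrite <- (mobius_0 a).
    apply (circle_max (fun z => q (mobius a z)) (- a)%C (/ s) t); auto.
    - intros z hz. apply ccont_comp.
      + now apply holo_at_cont, holo_mobius.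
      + now apply qc, mobius_lt_1.
    - intros z hz hza. apply holo_at_comp; [now apply holo_mobius|].
      apply qh; [now apply mobius_lt_1|]. intros E. apply hza.
      now apply mobius_inj_zero.
    - intros z hz. specialize (Ht z hz). unfold q.
      destruct (Ceq_dec (mobius a z) 0) as [E|hn].
      { rewrite E, Cmod_0 in Ht. lra. }
      rewrite Cmod_mult, Cmod_inv by exact hn.
      assert (hb' := hb (mobius a z) (mobius_lt_1 a z ha ltac:(lra))).
      assert (hi : / Cmod (mobius a z) <= / s) by (apply Rinv_le_contravar; lra).
      assert (hi0 : 0 < / Cmod (mobius a z)) by (apply Rinv_0_lt_compat; lra).
      assert (h0 := Cmod_ge_0 (v (mobius a z))). nra. }
  assert (hq : Cmod (q a) <= 1).
  { apply Rnot_lt_le. intros hlt. set (x := Cmod (q a)) in *.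
    (* If x > 1, this [s] lies strictly between 1/x and 1, so x s > 1 contradicts [key]. *)
    assert (hs : 0 < (/ x + 1) / 2 < 1).
    { assert (0 < / x) by (apply Rinv_0_lt_compat; lra).
      assert (/ x < 1) by (rewrite <- Rinv_1; apply Rinv_lt_contravar; lra). lra. }
    specialize (key _ hs).
    assert (key' : x * ((/ x + 1) / 2) <= 1).
    { apply Rle_trans with (/ ((/ x + 1) / 2) * ((/ x + 1) / 2)).
      - apply Rmult_le_compat_r; lra.
      - rewrite Rinv_l; lra. }
    replace (x * ((/ x + 1) / 2)) with ((1 + x) / 2) in key' by (field; lra). lra. }
  unfold q in hq. destruct (Ceq_dec a 0); [tauto|].
  rewrite Cmod_mult, Cmod_inv in hq by exact ha0.
  assert (hp0 := Cmod_pos _ ha0).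
  apply Rmult_le_reg_r with (/ Cmod a); [now apply Rinv_0_lt_compat|].
  rewrite Rinv_r by lra. exact hq.
Qed.

(* The Schwarz lemma for [L (w - w 0) / (L^2 - conj (w 0) w)]. *)
Lemma bounded_growth w L z :
  (forall z, Cmod z < 1 -> holo_at w z) ->
  (forall z, Cmod z < 1 -> Cmod (w z) <= L) ->
  Cmod (w 0) < L -> Cmod z < 1 ->
  Cmod (w z - w 0) * (L * (1 - Cmod z)) <= (L ^ 2 - Cmod (w 0) ^ 2) * Cmod z.
Proof.
  intros hw hL h0 hz. set (c := w 0%C) in *. assert (hc := Cmod_ge_0 c).
  assert (den : forall u, Cmod u <= L -> (RtoC (L ^ 2) - Cconj c * u)%C <> 0%C).
  { intros u hu E. assert (H := Cmod_triangle_inv (RtoC (L ^ 2)) (Cconj c * u)).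
    rewrite E, Cmod_0, Cmod_R, Cmod_mult, Cmod_conj in H.
    rewrite Rabs_right in H by nra. assert (h := Cmod_ge_0 u). nra. }
  set (v := fun z => (RtoC L * (w z + - c) * / (RtoC (L ^ 2) + - Cconj c * w z))%C).
  assert (den' : forall u, Cmod u <= L -> (RtoC (L ^ 2) + - Cconj c * u)%C <> 0%C).
  { intros u hu E. apply (den u hu). rewrite <- E. ring. }
  assert (S : Cmod (v z) <= Cmod z).
  { apply Schwarz_lemma; auto.
    - intros x hx. unfold v. apply holo_at_mult.
      + apply holo_at_mult; [apply holo_at_const|].
        apply holo_at_plus; [auto | apply holo_at_const].
      + apply holo_at_inv; [|auto]. apply holo_at_plus; [apply holo_at_const|].
        apply holo_at_mult; [apply holo_at_const | auto].
    - unfold v. fold c. ring.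
    - intros x hx. unfold v. assert (hd := den' _ (hL x hx)).
      assert (hp := Cmod_pos _ hd). rewrite Cmod_mult, Cmod_inv by exact hd.
      apply Rmult_le_reg_r with (Cmod (RtoC (L ^ 2) + - Cconj c * w x)); [exact hp|].
      rewrite Rmult_assoc, Rinv_l, Rmult_1_r, Rmult_1_l by lra.
      (* The difference of squared denominator and numerator factors into two nonnegative terms,
         hence |v| <= 1. *)
      assert (E : Cmod (RtoC (L ^ 2) + - Cconj c * w x) ^ 2 - Cmod (RtoC L * (w x + - c)) ^ 2
        = (L ^ 2 - Cmod (w x) ^ 2) * (L ^ 2 - Cmod c ^ 2)).
      { rewrite !Cmod_sqr. simpl. ring. }
      assert (h1 := hL x hx). assert (h2 := Cmod_ge_0 (w x)).
      assert (0 <= (L ^ 2 - Cmod (w x) ^ 2) * (L ^ 2 - Cmod c ^ 2))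
        by (apply Rmult_le_pos; nra).
      apply Rnot_lt_le. intros hlt. nra. }
  unfold v in S. assert (hd := den' _ (hL z hz)). assert (hp := Cmod_pos _ hd).
  rewrite Cmod_mult, Cmod_inv, Cmod_mult, Cmod_R, Rabs_right in S by (exact hd || lra).
  apply (Rmult_le_compat_r (Cmod (RtoC (L ^ 2) + - Cconj c * w z))) in S; [|lra].
  rewrite Rmult_assoc, Rinv_l, Rmult_1_r in S by lra.
  (* Expanding the denominator around [c] turns the Schwarz bound into L x <= r (L^2 - k^2 + k x),
     linear in x = |w(z) - c|; replacing k x by L x gives the claim. *)
  assert (T : Cmod (RtoC (L ^ 2) + - Cconj c * w z)
      <= (L ^ 2 - Cmod c ^ 2) + Cmod c * Cmod (w z - c)).
  { replace (RtoC (L ^ 2) + - Cconj c * w z)%C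
      with (RtoC (L ^ 2 - Cmod c ^ 2) + - (Cconj c * (w z - c)))%C.
    - refine (Rle_trans _ _ _ (Cmod_triangle _ _) _).
      rewrite Cmod_opp, Cmod_mult, Cmod_conj, Cmod_R, Rabs_right by nra. lra.
    - rewrite RtoC_minus, Cmod2_conj. ring. }
  change (w z + - c)%C with (w z - c)%C in S.
  assert (hz0 := Cmod_ge_0 z). assert (hx := Cmod_ge_0 (w z - c)).
  set (x := Cmod (w z - c)) in *. set (r := Cmod z) in *. set (k := Cmod c) in *.
  assert (r * Cmod (RtoC (L ^ 2) + - Cconj c * w z) <= r * (L ^ 2 - k ^ 2 + L * x)).
  { apply Rmult_le_compat_l; [exact hz0|]. nra. }
  lra.
Qed.

(** * The topology and measure of the plane *)

Module PlaneTopology.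
Import all_boot all_order all_algebra all_classical all_reals all_analysis.
Import Rstruct Rstruct_topology.
Import Order.TTheory GRing.Theory Num.Theory.
Delimit Scope R_scope with coqR.
Local Open Scope classical_set_scope.
Local Open Scope R_scope.
Local Notation Cm := Coquelicot.Complex.Cmod.

Lemma nbhs_Cmod (A : set C) (z : C) :
  nbhs z A <-> exists d, 0 < d /\ forall w, Cm (Cminus w z) < d -> A w.
Proof.
split.
- move=> /(@nbhs_ballP R (R * R)%type) [e /= /RltP e0 H]; exists e; split => // w hw.
  apply: H; split; rewrite /ball /=.
  + apply/RltP; rewrite -RabsE Rabs_minus_sym.
    by apply: Rle_lt_trans hw; exact: (fst_le_Cmod (Cminus w z)).
  + apply/RltP; rewrite -RabsE Rabs_minus_sym.
    by apply: Rle_lt_trans hw; exact: (snd_le_Cmod (Cminus w z)).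
- move=> [d [d0 H]]; apply/(@nbhs_ballP R (R * R)%type).
  have d2 : 0 < d / 2 by lra.
  exists (d / 2) => /=; first exact/RltP.
  move=> w [/RltP h1 /RltP h2]; apply: H.
  rewrite -RabsE Rabs_minus_sym in h1; rewrite -RabsE Rabs_minus_sym in h2.
  apply: Rle_lt_trans (Cmod_le_abs _) _ => /=.
  change (Rabs (w.1 - z.1) < d / 2) in h1.
  change (Rabs (w.2 - z.2) < d / 2) in h2.
  rewrite /Rminus in h1 h2; lra.
Qed.

Lemma open_Cmod (A : set C) :
  (forall z, A z -> exists d, 0 < d /\ forall w, Cm (Cminus w z) < d -> A w) ->
  topology_structure.open A.
Proof. by move=> H; rewrite openE => z /H h; exact/nbhs_Cmod. Qed.

Lemma ccont_continuous (f : C -> C) z : ccont f z -> {for z, continuous f}.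
Proof.
move=> H A /nbhs_Cmod[e [e0 He]].
apply/nbhs_Cmod; have [d [d0 Hd]] := H e e0.
by exists d; split => // w hw; apply/He/Hd.
Qed.

Lemma compact_closed_disk r : compact ([set z | Cm z <= r] : set C).
Proof.
have cb : compact (`[(- r)%R, r] `*` `[(- r)%R, r] : set (R * R)%type).
  by apply: compact_setX; exact: segment_compact.
apply: subclosed_compact cb _.
- rewrite -openC; apply: open_Cmod => z /= /Rnot_le_lt hz.
  exists (Cm z - r)%coqR; split; first lra.
  move=> w hw /= hw'; have := Cmod_triangle_inv z w.
  rewrite Cmod_minus_sym; lra.
- move=> z /= hz; have h1 := fst_le_Cmod z; have h2 := snd_le_Cmod z.
  have {}h1 := Rle_trans _ _ _ h1 hz; have {}h2 := Rle_trans _ _ _ h2 hz.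
  move: (proj1 (Rcomplements.Rabs_le_between _ _) h1) => [a b].
  move: (proj1 (Rcomplements.Rabs_le_between _ _) h2) => [a' b'].
  by split => /=; rewrite in_itv /=; apply/andP; split; apply/RleP.
Qed.

(** Continuity is asked only relative to the closed disk, because the contraction to which this is
    applied is controlled only there. *)
Lemma closed_disk_max (phi : C -> R) r : 0 <= r ->
  (forall z, Cm z <= r -> forall eps, 0 < eps -> exists d, 0 < d /\
    forall w, Cm w <= r -> Cm (Cminus w z) < d -> Rabs (phi w - phi z) < eps) ->
  exists a, Cm a <= r /\ forall z, Cm z <= r -> phi z <= phi a.
Proof.
move=> r0 H.
have [||a aD Ha] := @compact_EVT_max _ R phi _ _ (@compact_closed_disk r).
- by exists (RtoC 0); rewrite /= Cmod_0.
- rewrite continuous_subspace_in => z /set_mem /= hz A.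
  move=> /nbhs_ballP[e /= /RltP e0 He].
  have [d [d0 Hd]] := H z hz e e0.
  suff : within [set z | Cm z <= r] (nbhs z) (phi @^-1` A).
    by rewrite /= nbhs_subspace_in.
  apply/nbhs_Cmod; exists d; split => // w hw wr; apply: He.
  rewrite /ball /=; apply/RltP; rewrite -RabsE Rabs_minus_sym.
  exact: Hd.
- exists a; split; first by move/set_mem: aD.
  by move=> z hz; apply/RleP; apply: Ha; exact/mem_set.
Qed.

(** The disk is connected as a union of segments issuing from its centre. *)
Lemma connected_disk_image (g : C -> C) c r : 0 < r ->
  (forall w, Cm (Cminus w c) < r -> ccont g w) ->
  connected (g @` disk c r).
Proof.
move=> r0 H; apply: connected_continuous_connected; last first.
  by apply: continuous_in_subspaceT => w /set_mem hw; exact/ccont_continuous/H.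
pose seg (w : C) (t : R) : C := Cplus c (Cmult (RtoC t) (Cminus w c)).
have -> : disk c r = \bigcup_(w in disk c r) (seg w @` `[0%R, 1%R]).
  apply/seteqP; split => z.
    move=> hz; exists z => //; exists 1.
      by rewrite /= in_itv /= lexx ler01.
    by rewrite /seg Cmult_1_l; apply: injective_projections => /=; lra.
  move=> [w hw [t /=]]; rewrite in_itv /= => /andP[/RleP t0 /RleP t1] <-.
  rewrite /disk /= /seg.
  have -> : Cminus (Cplus c (Cmult (RtoC t) (Cminus w c))) c = Cmult (RtoC t) (Cminus w c).
    by apply: injective_projections => /=; lra.
  have h0 := Cmod_ge_0 (Cminus w c).
  rewrite /disk /= in hw.
  rewrite Cmod_mult Cmod_R Rabs_right; last by apply: Rle_ge.
  rewrite /one /= in t1; apply: Rle_lt_trans hw.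
  have t1' : t <= 1 by [].
  nra.
apply: bigcup_connected.
  exists c => w hw; exists 0; first by rewrite /= in_itv /= lexx ler01.
  by rewrite /seg; apply: injective_projections => /=; lra.
move=> w hw; apply: connected_continuous_connected; first exact: segment_connected.
apply: continuous_subspaceT => t.
move=> A /nbhs_Cmod[e [e0 He]]; apply/nbhs_ballP.
have h0 := Cmod_ge_0 (Cminus w c).
have k0 : 0 < e / (Cm (Cminus w c) + 1) by apply: Rdiv_lt_0_compat; lra.
exists (e / (Cm (Cminus w c) + 1)); first exact/RltP.
move=> s /RltP; rewrite -RabsE Rabs_minus_sym => hs; apply: He.
change (Rabs (s - t) < e / (Cm (Cminus w c) + 1)) in hs.
have -> : Cminus (seg w s) (seg w t) = Cmult (RtoC (s - t)) (Cminus w c).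
  by rewrite /seg; apply: injective_projections => /=; lra.
rewrite Cmod_mult Cmod_R.
have E : e / (Cm (Cminus w c) + 1) * (Cm (Cminus w c) + 1) = e.
  by field; lra.
have := Rabs_pos (s - t); nra.
Qed.

(** A null set cannot contain the open square of side d / 2 with lower left corner [z], which lies
    in the disk of radius [d] and has measure d^2 / 4. *)
Lemma ae_on_disk_dense (P : C -> Prop) z d : ae_on_disk P -> 0 < d ->
  (forall w, Cm (Cminus w z) < d -> Cm w < 1) ->
  exists w, Cm (Cminus w z) < d /\ P w.
Proof.
move=> [A [mA A0 HA]] d0 hd; apply: contrapT => hn.
have e0 : 0 < d / 2 by lra.
pose I (x : R) : set R := [set` Interval (BRight x) (BLeft (x + d / 2)%coqR)].
have sub : I z.1 `*` I z.2 `<=` A.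
  move=> w [/=]; rewrite /I /= !in_itv /= => /andP[/RltP a /RltP b] /andP[/RltP a' /RltP b'].
  have hw : Cm (Cminus w z) < d.
    apply: Rle_lt_trans (Cmod_le_abs _) _ => /=.
    change (w.1 + - z.1)%coqR with (w.1 - z.1)%coqR.
    change (w.2 + - z.2)%coqR with (w.2 - z.2)%coqR.
    rewrite !Rabs_right; lra.
  apply: HA => /= Pw; apply: hn; exists w; split => //.
  by apply: Pw; exact: hd.
have mI x : measurable (I x : set (measurableTypeR R)) by exact: measurable_itv.
have : (leb2 (I z.1 `*` I z.2) <= leb2 A)%E.
  by apply: le_measure => //; rewrite inE //; exact: measurableX.
have lebI x : lebesgue_measure (I x) = (d / 2)%coqR%:E.
  rewrite /I lebesgue_measure_itv /= lte_fin.
  have -> : (x < (x + d / 2)%coqR)%R by apply/RltP; lra.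
  by rewrite -EFinB -RminusE; congr _%:E; lra.
rewrite A0 /leb2 product_measure1E // [X in (X * _)%E]lebI [X in (_ * X)%E]lebI.
rewrite -EFinM lee_fin -RmultE => /RleP h.
have : 0 < d / 2 * (d / 2) by nra.
change (d / 2 * (d / 2) <= 0) in h; lra.
Qed.

(** The domain is the image of the target disk under [Phi] composed with the inverse branch [g] of
    [f o Phi]. Continuity of the inverse is a hypothesis, available from the expansion estimate, so
    that invariance of domain is not invoked. *)
Lemma univalent_disk_of_parametrization (f Phi Psi : C -> C) c rho r0 : 0 < rho ->
  (forall z, Cm z < 1 -> ccont f z) ->
  (forall x, Cm x < r0 -> Cm (Phi x) < 1 /\ ccont Phi x) ->
  (forall x, Cm x < r0 -> Psi (Phi x) = x /\ ccont Psi (Phi x)) ->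
  (forall x, Cm x < r0 -> exists d, 0 < d /\
     forall w, Cm (Cminus w (Phi x)) < d -> Phi (Psi w) = w) ->
  (forall x y, Cm x < r0 -> Cm y < r0 -> f (Phi x) = f (Phi y) -> x = y) ->
  (forall w, Cm (Cminus w c) < rho -> exists x, Cm x < r0 /\ f (Phi x) = w) ->
  (forall x, Cm x < r0 -> Cm (Cminus (f (Phi x)) c) < rho ->
     forall eps, 0 < eps -> exists d, 0 < d /\ forall y, Cm y < r0 ->
       Cm (Cminus (f (Phi y)) (f (Phi x))) < d -> Cm (Cminus y x) < eps) ->
  univalent_disk f c rho.
Proof.
move=> rho0 fc Phi_cont Psi_K Psi_cont f_inj f_surj inv_cont; split => //.
have [g Hg] : exists g : C -> C, forall w, Cm (Cminus w c) < rho ->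
    Cm (g w) < r0 /\ f (Phi (g w)) = w.
  (* Outside the target disk [g] takes the default value 0. *)
  suff /choice [g Hg] : forall w, exists x, Cm (Cminus w c) < rho ->
      Cm x < r0 /\ f (Phi x) = w by exists g.
  move=> w; have [h|h] := pselect (Cm (Cminus w c) < rho).
    by have [x hx] := f_surj w h; exists x.
  by exists (RtoC 0).
have gK x : Cm x < r0 -> Cm (Cminus (f (Phi x)) c) < rho -> g (f (Phi x)) = x.
  by move=> hx hr; have [a b] := Hg _ hr; exact: f_inj.
have g_cont w : Cm (Cminus w c) < rho -> ccont g w.
  move=> hw eps e0; have [gr gw] := Hg w hw.
  have [|d [d0 Hd]] := inv_cont (g w) gr _ eps e0; first by rewrite gw.
  have [d' [d'0 Hd']] := Cmod_lt_margin _ _ _ hw.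
  exists (Rmin d d'); split; first exact: Rmin_pos.
  move=> v hv; have h1 := Rmin_l d d'; have h2 := Rmin_r d d'.
  have hvc : Cm (Cminus v c) < rho by apply: Hd'; lra.
  have [vr vw] := Hg v hvc.
  by apply: Hd => //; rewrite gw vw; lra.
exists ((fun w => Phi (g w)) @` disk c rho); split.
- split.
  + exists (Phi (g c)), c => //.
    by rewrite /disk /=; have := Cmod_minus_diag c => /= ->.
  (* For [v] near a point of the image, [Psi v] stays in the parameter disk and [f v] in the target
     disk, and then v = Phi (Psi v) = Phi (g (f v)). *)
  + apply: open_Cmod => _ [w hw <-]; have [gr gw] := Hg w hw.
    have [Phi1 _] := Phi_cont _ gr; have [PK Pc] := Psi_K _ gr.
    have [d1 [d10 H1]] := Psi_cont _ gr.
    have [d2 [d20 H2]] := Pc (r0 - Cm (g w))%coqR ltac:(lra).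
    have [d3 [d30 H3]] := fc _ Phi1 (rho - Cm (Cminus w c))%coqR ltac:(rewrite /disk /= in hw; lra).
    exists (Rmin d1 (Rmin d2 d3)); split; first by do 2! apply: Rmin_pos => //.
    have m1 := Rmin_l d1 (Rmin d2 d3); have m2 := Rmin_r d1 (Rmin d2 d3).
    have m3 := Rmin_l d2 d3; have m4 := Rmin_r d2 d3.
    move=> v hv.
    have {}H2 := H2 v ltac:(lra); have {}H3 := H3 v ltac:(lra).
    have hPsi : Cm (Psi v) < r0.
      by have := Cmod_triangle_inv (Psi v) (g w); rewrite PK in H2; lra.
    have {}H1 := H1 v ltac:(lra).
    have hfv : Cm (Cminus (f v) c) < rho.
      rewrite gw in H3; have := Cmod_triang_minus (f v) w c; lra.
    exists (f v) => //.
    by rewrite -{2}H1 -[in f v]H1 gK // H1.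
  + apply: connected_disk_image => // w hw; apply: ccont_comp; first exact: g_cont.
    by have [gr _] := Hg w hw; have [] := Phi_cont _ gr.
- by move=> _ [w hw <-]; have [gr _] := Hg w hw; have [] := Phi_cont _ gr.
- split.
  + by move=> _ [w hw <-]; have [_ ->] := Hg w hw.
  + move=> x y /set_mem[w hw <-] /set_mem[v hv <-].
    by have [_ ->] := Hg w hw; have [_ ->] := Hg v hv => ->.
  + move=> w hw; exists (Phi (g w)); first by exists w.
    by have [_ ->] := Hg w hw.
Qed.

End PlaneTopology.

(** * A Landau theorem for harmonic maps *)

Lemma increment_le (phi psi dphi dpsi : R -> R) a b : a <= b ->
  (forall t, a <= t <= b -> is_derive phi t (dphi t)) ->
  (forall t, a <= t <= b -> is_derive psi t (dpsi t)) ->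
  (forall t, a <= t <= b -> dphi t <= dpsi t) ->
  phi b - phi a <= psi b - psi a.
Proof.
  intros hab h1 h2 h3.
  destruct (MVT_gen (fun t => psi t - phi t) a b (fun t => dpsi t - dphi t))
    as [c [hc E]]; rewrite ?Rmin_left, ?Rmax_right in * by exact hab.
  - intros t ht. apply (is_derive_minus (V := R_NormedModule)); [apply h2 | apply h1]; lra.
  - intros t ht. apply derivable_continuous_pt. exists (dpsi t - dphi t).
    apply is_derive_Reals.
    apply (is_derive_minus (V := R_NormedModule)); [apply h2 | apply h1]; lra.
  - specialize (h3 c hc). nra.
Qed.

Lemma inner_le_Cmod (c d : C) : fst c * fst d + snd c * snd d <= Cmod c * Cmod d.
Proof.
  rewrite <- (Cmod_conj c), <- Cmod_mult.
  refine (Rle_trans _ _ _ _ (fst_le_Cmod _)).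
  refine (Rle_trans _ _ _ _ (Rle_abs _)). simpl. right. ring.
Qed.

(** The mean value inequality for plane curves: projecting the curve onto the direction [D] of its
    total displacement reduces it to the scalar case. *)
Lemma curve_increment_le (x y dx dy psi dpsi : R -> R) :
  (forall t, 0 <= t <= 1 -> is_derive x t (dx t)) ->
  (forall t, 0 <= t <= 1 -> is_derive y t (dy t)) ->
  (forall t, 0 <= t <= 1 -> is_derive psi t (dpsi t)) ->
  (forall t, 0 <= t <= 1 -> Cmod (dx t, dy t) <= dpsi t) ->
  Cmod ((x 1, y 1) - (x 0, y 0)) <= psi 1 - psi 0.
Proof.
  intros hx hy hp hle. set (D := ((x 1, y 1) - (x 0, y 0))%C).
  destruct (Ceq_dec D 0) as [E|hn].
  - rewrite E, Cmod_0.
    replace 0 with ((fun _ : R => 0) 1 - (fun _ : R => 0) 0) at 1 by ring.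
    apply (increment_le (fun _ => 0) psi (fun _ => 0) dpsi); auto; [lra | |].
    + intros t _. apply (is_derive_const (V := R_NormedModule)).
    + intros t ht. eapply Rle_trans; [apply Cmod_ge_0 | now apply hle].
  - assert (hD := Cmod_pos _ hn). apply Rmult_le_reg_l with (Cmod D); [exact hD|].
    replace (Cmod D * Cmod D) with (Cmod D ^ 2) by ring. rewrite Cmod_sqr.
    set (phi := fun t => fst D * x t + snd D * y t).
    replace (fst D ^ 2 + snd D ^ 2) with (phi 1 - phi 0) by (unfold phi, D; simpl; ring).
    replace (Cmod D * (psi 1 - psi 0))
      with (Cmod D * psi 1 - Cmod D * psi 0) by ring.
    apply (increment_le phi (fun t => Cmod D * psi t)
      (fun t => fst D * dx t + snd D * dy t) (fun t => Cmod D * dpsi t)); [lra | | |].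
    + intros t ht. apply (is_derive_plus (V := R_NormedModule));
        apply is_derive_scal; auto.
    + intros t ht. apply is_derive_scal; auto.
    + intros t ht. refine (Rle_trans _ _ _ (inner_le_Cmod D (dx t, dy t)) _).
      apply Rmult_le_compat_l; [lra | auto].
Qed.

(** The unit a / |a| times conj b / |b| turns [b] into the direction of [a]. This trades a sum of
    two moduli for one modulus, both for holomorphic functions and for the norm of the
    differential. *)
Lemma align_unit (a b : C) : exists c : C,
  Cmod c = 1 /\ Cmod (a + c * b) = Cmod a + Cmod b.
Proof.
  destruct (Ceq_dec a 0) as [->|ha].
  { exists 1%C. rewrite Cmod_1, Cmod_0. split; auto.
    replace (0 + 1 * b)%C with b by ring. lra. }
  destruct (Ceq_dec b 0) as [->|hb].
  { exists 1%C. rewrite Cmod_1, Cmod_0. split; auto.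
    replace (a + 1 * 0)%C with a by ring. lra. }
  assert (pa := Cmod_pos _ ha). assert (pb := Cmod_pos _ hb).
  assert (na : RtoC (Cmod a) <> 0%C) by (intros E; apply (f_equal fst) in E; simpl in E; lra).
  assert (nb : RtoC (Cmod b) <> 0%C) by (intros E; apply (f_equal fst) in E; simpl in E; lra).
  exists (a / Cmod a * (Cconj b / Cmod b))%C. split.
  - rewrite Cmod_mult, !Cmod_div, Cmod_conj, !Cmod_R, !Rabs_right by (auto; lra).
    field. lra.
  - replace (a + a / Cmod a * (Cconj b / Cmod b) * b)%C
      with (a * RtoC (1 + Cmod b / Cmod a))%C.
    + rewrite Cmod_mult, Cmod_R, Rabs_right.
      * field. lra.
      * assert (0 < Cmod b / Cmod a) by (apply Rdiv_lt_0_compat; lra). lra.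
    + rewrite RtoC_plus, RtoC_div by lra.
      transitivity (a + a / Cmod a / Cmod b * (b * Cconj b))%C; [|field; auto].
      rewrite <- Cmod2_conj. replace (Cmod b ^ 2) with (Cmod b * Cmod b) by ring.
      rewrite RtoC_mult. field. auto.
Qed.

(* Apply [bounded_growth] to [H' + c G'], where the unit [c] aligns the two
   increments. *)
Lemma derivative_variation H' G' L z :
  (forall z, Cmod z < 1 -> holo_at H' z) -> (forall z, Cmod z < 1 -> holo_at G' z) ->
  (forall z, Cmod z < 1 -> Cmod (H' z) + Cmod (G' z) <= L) ->
  Cmod (H' 0) + Cmod (G' 0) < L -> 1 <= Cmod (H' 0) - Cmod (G' 0) ->
  Cmod z < 1 ->
  Cmod (H' z - H' 0) + Cmod (G' z - G' 0) <= (L - / L) * (Cmod z / (1 - Cmod z)).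
Proof.
  intros hH hG hL h0 h1 hz.
  destruct (align_unit (H' z - H' 0) (G' z - G' 0)) as [c [hc E]]. rewrite <- E.
  assert (g0 := Cmod_ge_0 (G' 0)). assert (z0 := Cmod_ge_0 z).
  set (w := fun z => (H' z + c * G' z)%C).
  assert (B : Cmod (w z - w 0%C) * (L * (1 - Cmod z)) <= (L ^ 2 - Cmod (w 0%C) ^ 2) * Cmod z).
  { apply bounded_growth; auto.
    - intros x hx. apply holo_at_plus; auto. apply holo_at_mult; auto using holo_at_const.
    - intros x hx. refine (Rle_trans _ _ _ (Cmod_triangle _ _) _).
      rewrite Cmod_mult, hc, Rmult_1_l. auto.
    - refine (Rle_lt_trans _ _ _ (Cmod_triangle _ _) _).
      rewrite Cmod_mult, hc, Rmult_1_l. auto. }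
  assert (W : 1 <= Cmod (w 0%C)).
  { assert (T := Cmod_triangle_inv (H' 0) (- (c * G' 0))).
    rewrite Cmod_opp, Cmod_mult, hc, Rmult_1_l in T.
    replace (H' 0 - - (c * G' 0))%C with (w 0%C) in T by (unfold w; ring). lra. }
  replace (H' z - H' 0 + c * (G' z - G' 0))%C with (w z - w 0)%C by (unfold w; ring).
  set (x := Cmod (w z - w 0)) in *.
  apply Rmult_le_reg_r with (L * (1 - Cmod z)); [nra|].
  replace ((L - / L) * (Cmod z / (1 - Cmod z)) * (L * (1 - Cmod z)))
    with ((L ^ 2 - 1) * Cmod z) by (field; lra).
  refine (Rle_trans _ _ _ B _). apply Rmult_le_compat_r; nra.
Qed.

(** * Injectivity and covering for a map close to its differential at 0 *)

Section Landau.
Variables (H G H' G' : C -> C) (m : R).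
Hypothesis m_pos : 0 < m.
Hypothesis dH : forall z, Cmod z < 1 -> cderiv H z (H' z).
Hypothesis dG : forall z, Cmod z < 1 -> cderiv G z (G' z).
Hypothesis h1 : 1 <= Cmod (H' 0) - Cmod (G' 0).
Hypothesis var : forall z, Cmod z < 1 ->
  Cmod (H' z - H' 0) + Cmod (G' z - G' 0) <= m * (Cmod z / (1 - Cmod z)).

Let F z := (H z + Cconj (G z))%C.
Let lin z := (H' 0 * z + Cconj (G' 0 * z))%C.
Let err z := (F z - F 0 - lin z)%C.

(** Up to a constant, [err] is a + conj b with a' = H' - H'(0) and b' = G' - G'(0), so [var] bounds
    its speed along the segment. The majorant [psi] is left free: it is linear in the Lipschitz
    estimate and logarithmic in the bound from 0. *)
Lemma err_increment z1 z2 (psi dpsi : R -> R) : Cmod z1 < 1 -> Cmod z2 < 1 ->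
  (forall t, 0 <= t <= 1 -> is_derive psi t (dpsi t)) ->
  (forall t z, 0 <= t <= 1 -> z = (z1 + t * (z2 - z1))%C -> Cmod z < 1 ->
     m * (Cmod z / (1 - Cmod z)) * Cmod (z2 - z1) <= dpsi t) ->
  Cmod (err z2 - err z1) <= psi 1 - psi 0.
Proof.
  intros hz1 hz2 hpsi hle.
  set (x := fun t => fst z1 + t * (fst z2 - fst z1)).
  set (y := fun t => snd z1 + t * (snd z2 - snd z1)).
  assert (xy : forall t, (x t, y t) = (z1 + t * (z2 - z1))%C).
  { intros t. apply injective_projections; unfold x, y; simpl; ring. }
  assert (hin : forall t, 0 <= t <= 1 -> Cmod (x t, y t) < 1).
  { intros t ht. rewrite xy. replace (z1 + t * (z2 - z1))%C
      with (RtoC (1 - t) * z1 + RtoC t * z2)%C by (rewrite RtoC_minus; ring).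
    refine (Rle_lt_trans _ _ _ (Cmod_triangle _ _) _).
    rewrite !Cmod_mult, !Cmod_R, !Rabs_right by lra.
    assert (Cmod z1 <= Rmax (Cmod z1) (Cmod z2)) by apply Rmax_l.
    assert (Cmod z2 <= Rmax (Cmod z1) (Cmod z2)) by apply Rmax_r.
    assert (Rmax (Cmod z1) (Cmod z2) < 1) by now apply Rmax_lub_lt.
    nra. }
  assert (derx : forall t, is_derive x t (fst z2 - fst z1)).
  { intros t. unfold x. auto_derive; auto. ring. }
  assert (dery : forall t, is_derive y t (snd z2 - snd z1)).
  { intros t. unfold y. auto_derive; auto. ring. }
  set (a := fun z => (H z + - (H' 0 * z))%C). set (b := fun z => (G z + - (G' 0 * z))%C).
  assert (da : forall z, Cmod z < 1 -> cderiv a z (H' z - H' 0)%C).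
  { intros z hz. replace (H' z - H' 0)%C with (H' z + (0 * z + - H' 0 * 1))%C by ring.
    apply cderiv_ext_loc with (fun z => H z + (- H' 0) * z)%C 1; [lra | |].
    - intros w _. unfold a. ring.
    - apply cderiv_plus; auto.
      apply (cderiv_mult (fun _ => - H' 0)%C (fun w => w)); auto using cderiv_const, cderiv_id. }
  assert (db : forall z, Cmod z < 1 -> cderiv b z (G' z - G' 0)%C).
  { intros z hz. replace (G' z - G' 0)%C with (G' z + (0 * z + - G' 0 * 1))%C by ring.
    apply cderiv_ext_loc with (fun z => G z + (- G' 0) * z)%C 1; [lra | |].
    - intros w _. unfold b. ring.
    - apply cderiv_plus; auto.
      apply (cderiv_mult (fun _ => - G' 0)%C (fun w => w)); auto using cderiv_const, cderiv_id. }
  set (ex := fun t => fst (a (x t, y t)) + fst (b (x t, y t))).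
  set (ey := fun t => snd (a (x t, y t)) - snd (b (x t, y t))).
  assert (E : (err z2 - err z1)%C = ((ex 1, ey 1) - (ex 0, ey 0))%C).
  { unfold ex, ey. rewrite !xy.
    replace (z1 + 1 * (z2 - z1))%C with z2 by ring.
    replace (z1 + 0 * (z2 - z1))%C with z1 by ring.
    unfold err, F, lin, a, b. apply injective_projections; simpl; ring. }
  rewrite E.
  set (d := (fst z2 - fst z1, snd z2 - snd z1)).
  assert (hd : d = (z2 - z1)%C) by (apply injective_projections; simpl; ring).
  set (da' := fun t => ((H' (x t, y t) - H' 0) * d)%C).
  set (db' := fun t => ((G' (x t, y t) - G' 0) * d)%C).
  apply curve_increment_le with (fun t => fst (da' t) + fst (db' t))
    (fun t => snd (da' t) - snd (db' t)) dpsi; auto.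
  - intros t ht. assert (hi := hin t ht).
    apply (is_derive_plus (V := R_NormedModule)).
    + exact (proj1 (cderiv_curve a x y t _ _ _ (da _ hi) (derx t) (dery t))).
    + exact (proj1 (cderiv_curve b x y t _ _ _ (db _ hi) (derx t) (dery t))).
  - intros t ht. assert (hi := hin t ht).
    apply (is_derive_minus (V := R_NormedModule)).
    + exact (proj2 (cderiv_curve a x y t _ _ _ (da _ hi) (derx t) (dery t))).
    + exact (proj2 (cderiv_curve b x y t _ _ _ (db _ hi) (derx t) (dery t))).
  - intros t ht. assert (hi := hin t ht).
    refine (Rle_trans _ _ _ _ (hle t _ ht (xy t) hi)).
    replace (fst (da' t) + fst (db' t), snd (da' t) - snd (db' t))
      with (da' t + Cconj (db' t))%C by (apply injective_projections; simpl; ring).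
    refine (Rle_trans _ _ _ (Cmod_triangle _ _) _).
    rewrite Cmod_conj. unfold da', db'. rewrite !Cmod_mult, hd, <- Rmult_plus_distr_r.
    apply Rmult_le_compat_r; [apply Cmod_ge_0 | auto].
Qed.

Lemma err_lipschitz rho z1 z2 : 0 <= rho < 1 -> Cmod z1 <= rho -> Cmod z2 <= rho ->
  Cmod (err z2 - err z1) <= m * (rho / (1 - rho)) * Cmod (z2 - z1).
Proof.
  intros hr hz1 hz2. set (k := m * (rho / (1 - rho)) * Cmod (z2 - z1)).
  replace k with ((fun t => k * t) 1 - (fun t => k * t) 0) by ring.
  apply (err_increment z1 z2 (fun t => k * t) (fun _ => k)); [lra | lra | |].
  - intros t _. auto_derive; auto. ring.
  - intros t z ht -> hz. unfold k. apply Rmult_le_compat_r; [apply Cmod_ge_0|].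
    assert (hzr : Cmod (z1 + t * (z2 - z1)) <= rho).
    { replace (z1 + t * (z2 - z1))%C
        with (RtoC (1 - t) * z1 + RtoC t * z2)%C by (rewrite RtoC_minus; ring).
      refine (Rle_trans _ _ _ (Cmod_triangle _ _) _).
      rewrite !Cmod_mult, !Cmod_R, !Rabs_right by lra. nra. }
    assert (hz0 := Cmod_ge_0 (z1 + t * (z2 - z1))).
    apply Rmult_le_compat_l; [lra|]. unfold Rdiv.
    apply Rmult_le_compat; [lra | | lra |].
    + left. apply Rinv_0_lt_compat. lra.
    + apply Rinv_le_contravar; lra.
Qed.

(** The right-hand side is the integral of m t / (1 - t) from 0 to |z|, that is, [var] integrated
    along the radius. *)
Lemma err_bound z : Cmod z < 1 -> Cmod (err z) <= - m * (Cmod z + ln (1 - Cmod z)).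
Proof.
  intros hz. assert (hz0 := Cmod_ge_0 z). set (r := Cmod z) in *.
  assert (E0 : err 0%C = 0%C) by (unfold err, lin, F; apply injective_projections; simpl; ring).
  replace (err z) with (err z - err 0%C)%C by (rewrite E0; ring).
  set (psi := fun t => - m * (t * r + ln (1 - t * r))).
  replace (- m * (r + ln (1 - r))) with (psi 1 - psi 0).
  2:{ unfold psi. rewrite !Rmult_0_l, Rminus_0_r, ln_1, Rmult_1_l. ring. }
  apply (err_increment 0%C z psi (fun t => m * (t * r / (1 - t * r)) * r)).
  - rewrite Cmod_0. lra.
  - exact hz.
  - intros t ht. assert (0 < 1 - t * r) by nra. unfold psi. auto_derive; [exact H0|].
    field. lra.
  - intros t w ht -> hw. replace (0 + t * (z - 0))%C with (RtoC t * z)%C by ring.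
    replace (z - 0)%C with z by ring.
    rewrite Cmod_mult, Cmod_R, Rabs_right by lra. fold r. lra.
Qed.

(** The least stretch of [lin] is |H'(0)| - |G'(0)|, at least 1 by [h1]. *)
Lemma lin_lower z : Cmod z <= Cmod (lin z).
Proof.
  unfold lin. assert (T := Cmod_triangle_inv (H' 0 * z) (- Cconj (G' 0 * z))).
  rewrite Cmod_opp, Cmod_conj, !Cmod_mult in T.
  replace (H' 0 * z - - Cconj (G' 0 * z))%C
    with (H' 0 * z + Cconj (G' 0 * z))%C in T by ring.
  assert (z0 := Cmod_ge_0 z). nra.
Qed.

Lemma lin_minus z w : lin (z - w) = (lin z - lin w)%C.
Proof. unfold lin. apply injective_projections; simpl; ring. Qed.

(** Cramer's rule for the real-linear map [lin], whose determinant is |H'(0)|^2 - |G'(0)|^2. *)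
Let linv y :=
  ((Cconj (H' 0) * y - Cconj (G' 0) * Cconj y)
    / RtoC (fst (H' 0) ^ 2 + snd (H' 0) ^ 2 - (fst (G' 0) ^ 2 + snd (G' 0) ^ 2)))%C.

Lemma lin_linv y : lin (linv y) = y.
Proof.
  assert (g0 := Cmod_ge_0 (G' 0)).
  assert (hD : Cmod (H' 0) ^ 2 - Cmod (G' 0) ^ 2 <> 0) by nra.
  rewrite !Cmod_sqr in hD.
  unfold lin, linv, Cdiv. rewrite <- RtoC_inv by exact hD.
  apply injective_projections; simpl; field;
    intros E; apply hD; (eapply eq_trans; [|exact E]); ring.
Qed.

(** When the factor on the left is positive this gives injectivity and, at the same time, a
    Lipschitz inverse. *)
Lemma landau_expand rho z1 z2 : 0 <= rho < 1 -> Cmod z1 <= rho -> Cmod z2 <= rho ->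
  (1 - m * (rho / (1 - rho))) * Cmod (z2 - z1) <= Cmod (F z2 - F z1).
Proof.
  intros hr hz1 hz2. assert (E := err_lipschitz rho z1 z2 hr hz1 hz2).
  assert (A := lin_lower (z2 - z1)). rewrite lin_minus in A.
  assert (T := Cmod_triangle_inv (lin z2 - lin z1) (- (err z2 - err z1))).
  rewrite Cmod_opp in T.
  replace (lin z2 - lin z1 - - (err z2 - err z1))%C with (F z2 - F z1)%C in T
    by (unfold err; ring). lra.
Qed.

(* [F z = F 0 + w] is the fixed-point equation [z = T z] of
   [T z = lin^-1 (w - err z)], a contraction of the closed disk of radius
   [rho]; a point minimizing [|T z - z|] is fixed. *)
Lemma landau_cover rho w : 0 <= rho -> m * (rho / (1 - rho)) < 1 -> rho < 1 ->
  Cmod w <= (1 + m) * rho + m * ln (1 - rho) ->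
  exists z, Cmod z <= rho /\ F z = (F 0 + w)%C.
Proof.
  intros hr0 hk hr1 hw.
  set (T := fun z => linv (w - err z)).
  assert (HT : forall z, lin (T z) = (w - err z)%C) by (intros z; apply lin_linv).
  assert (hT : forall z1 z2, Cmod (T z2 - T z1) <= Cmod (err z2 - err z1)).
  { intros z1 z2. refine (Rle_trans _ _ _ (lin_lower _) _).
    rewrite lin_minus, !HT. right.
    rewrite <- Cmod_opp. f_equal. ring. }
  (* The bound on [w] is [rho] minus the largest value - m (rho + ln (1 - rho)) allowed for |err|,
     exactly what makes the closed disk invariant. *)
  assert (hTr : forall z, Cmod z <= rho -> Cmod (T z) <= rho).
  { intros z hz. refine (Rle_trans _ _ _ (lin_lower _) _). rewrite HT.
    assert (B : Cmod (err z) <= - m * (rho + ln (1 - rho))).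
    { refine (Rle_trans _ _ _ (err_bound z ltac:(lra)) _). assert (hz0 := Cmod_ge_0 z).
      set (psi := fun t => - m * (t + ln (1 - t))).
      assert (I : (fun _ : R => 0) rho - (fun _ : R => 0) (Cmod z) <= psi rho - psi (Cmod z)).
      { apply (increment_le (fun _ => 0) psi (fun _ => 0) (fun t => m * (t / (1 - t)))); [lra | | |].
        - intros t _. apply (is_derive_const (V := R_NormedModule)).
        - intros t ht. unfold psi. auto_derive; [lra|]. field. lra.
        - intros t ht. apply Rmult_le_pos; [lra|].
          apply Rmult_le_pos; [lra|]. left. apply Rinv_0_lt_compat. lra. }
      unfold psi in I. lra. }
    refine (Rle_trans _ _ _ (Cmod_triangle _ _) _). rewrite Cmod_opp. lra. }
  set (k := m * (rho / (1 - rho))) in *.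
  assert (k0 : 0 <= k).
  { apply Rmult_le_pos; [lra|]. apply Rmult_le_pos; [lra|].
    left. apply Rinv_0_lt_compat. lra. }
  assert (hTk : forall z1 z2, Cmod z1 <= rho -> Cmod z2 <= rho ->
    Cmod (T z2 - T z1) <= k * Cmod (z2 - z1)).
  { intros z1 z2 a b. refine (Rle_trans _ _ _ (hT _ _) _). now apply err_lipschitz. }
  destruct (PlaneTopology.closed_disk_max (fun z => - Cmod (T z - z)) rho hr0)
    as [z [hz Hz]].
  { intros z hz eps he. exists (eps / 2). split; [lra|]. intros u hu huz.
    assert (B := hTk z u hz hu). assert (p := Cmod_ge_0 (u - z)).
    assert (S1 := Cmod_triangle_inv (T u - u) (T z - z)).
    assert (S2 := Cmod_triangle_inv (T z - z) (T u - u)).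
    rewrite (Cmod_minus_sym (T z - z)) in S2.
    replace (T u - u - (T z - z))%C with ((T u - T z) - (u - z))%C in S1, S2 by ring.
    assert (S3 := Cmod_triangle (T u - T z) (- (u - z))). rewrite Cmod_opp in S3.
    change (T u - T z + - (u - z))%C with (T u - T z - (u - z))%C in S3.
    apply Rabs_def1; nra. }
  exists z. split; [exact hz|].
  assert (hfix : T z = z).
  { destruct (Ceq_dec (T z - z) 0) as [E|hn].
    - replace (T z) with ((T z - z) + z)%C by ring. rewrite E. ring.
    - exfalso. assert (hp := Cmod_pos _ hn).
      (* Otherwise [T z] is displaced by at most k < 1 times the minimal displacement. *)
      assert (M := Hz (T z) (hTr z hz)). assert (B := hTk z (T z) hz (hTr z hz)). nra. }
  assert (E := HT z). rewrite hfix in E. unfold err in E.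
  replace (F z) with (F 0 + lin z + (F z - F 0 - lin z))%C by ring.
  rewrite E at 1. ring.
Qed.
End Landau.

(** * The Wirtinger derivatives of a harmonic map *)

Lemma cderiv_intro f z l :
  (forall eps, 0 < eps -> exists d, 0 < d /\ forall w, Cmod (w - z) < d ->
     Cmod (f w - f z - l * (w - z)) <= eps * Cmod (w - z)) -> cderiv f z l.
Proof.
  intros H. exists (fun w => if Ceq_dec w z then l else ((f w - f z) / (w - z))%C).
  assert (sub0 : forall w, w <> z -> (w - z)%C <> 0%C).
  { intros w hw E. apply hw. replace w with ((w - z) + z)%C by ring. rewrite E. ring. }
  split; [|split].
  - intros eps he. destruct (H (eps / 2)) as [d [hd Hd]]; [lra|].
    exists d. split; [exact hd|]. intros w hw.
    destruct (Ceq_dec z z) as [_|]; [|tauto].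
    destruct (Ceq_dec w z) as [->|hn]; [rewrite Cmod_minus_diag; lra|].
    specialize (Hd w hw). assert (hs := sub0 w hn). assert (hp := Cmod_pos _ hs).
    replace ((f w - f z) / (w - z) - l)%C
      with ((f w - f z - l * (w - z)) / (w - z))%C by (field; exact hs).
    rewrite Cmod_div by exact hs.
    apply Rle_lt_trans with (eps / 2); [|lra].
    apply Rmult_le_reg_r with (Cmod (w - z)); [exact hp|].
    unfold Rdiv at 1. rewrite Rmult_assoc, Rinv_l by lra. lra.
  - destruct (Ceq_dec z z); tauto.
  - exists 1. split; [lra|]. intros w _.
    destruct (Ceq_dec w z) as [->|hn]; [ring|]. field. now apply sub0.
Qed.

Lemma ex_derive_cderiv (f : C -> C) z :
  @ex_derive C_AbsRing C_NormedModule f z -> exists l, cderiv f z l.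
Proof.
  intros [l [_ H]]. exists l. apply cderiv_intro. intros eps he.
  destruct (H z (fun P hP => hP) (mkposreal _ he)) as [d Hd].
  exists d. split; [apply cond_pos|]. intros w hw. specialize (Hd w hw).
  replace (f w - f z - l * (w - z))%C with (f w - f z - (w - z) * l)%C by ring.
  exact Hd.
Qed.

Lemma disk_locally_2d z : Cmod z < 1 ->
  locally_2d (fun u v => Cmod (u, v) < 1) (fst z) (snd z).
Proof.
  intros hz. assert (hp : 0 < (1 - Cmod z) / 2) by lra.
  exists (mkposreal _ hp). simpl. intros u v hu hv.
  assert (T := Cmod_triangle_inv (u, v) z). assert (L := Cmod_le_abs ((u, v) - z)).
  simpl in L. unfold Rminus in *. lra.
Qed.

Lemma C1_differentiable (u : C -> R) z : C1_on_disk u -> Cmod z < 1 ->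
  differentiable_pt_lim (fun x y => u (x, y)) (fst z) (snd z) (px u z) (py u z).
Proof.
  intros Hu hz. apply filterdiff_differentiable_pt_lim.
  assert (Hz := Hu z hz). destruct Hz as [_ Hy Hcx _].
  assert (D := is_derive_filterdiff (fun x y => u (x, y)) (fst z) (snd z)
    (fun x y => px u (x, y)) (py u z)).
  eapply filterdiff_ext_lin.
  - apply D.
    + apply (locally_2d_locally
        (fun x y => is_derive (fun t => u (t, y)) x (px u (x, y)))).
      generalize (disk_locally_2d z hz). apply locally_2d_impl, locally_2d_forall.
      intros x y h. apply Derive_correct. now destruct (Hu (x, y) h).
    + now apply Derive_correct.
    + rewrite <- surjective_pairing.
      apply continuous_ext with (px u); [|exact Hcx].
      intros w. now rewrite <- surjective_pairing.
  - intros w. simpl. rewrite <- surjective_pairing. reflexivity.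
Qed.

Lemma C1_continuity_2d (q : C -> R) z : Coquelicot.Continuity.continuous q z ->
  continuity_2d_pt (fun x y => q (x, y)) (fst z) (snd z).
Proof.
  intros H. apply continuity_2d_pt_filterlim.
  assert (E : forall w : C, q w = q (fst w, snd w)).
  { intros w. now rewrite <- surjective_pairing. }
  rewrite <- E, <- surjective_pairing.
  apply filterlim_ext with q; [exact E | exact H].
Qed.

(** This is the symmetry of second derivatives ([Schwarz]). The given [p] and [q] are the first
    partials only inside the disk, so [nx] and [ny] substitute them locally under the outer
    derivative. *)
Lemma mixed_partials (u p q : C -> R) z : Cmod z < 1 ->
  C1_on_disk p -> C1_on_disk q ->
  (forall w, Cmod w < 1 -> is_derive (fun t => u (t, snd w)) (fst w) (p w) /\
                           is_derive (fun t => u (fst w, t)) (snd w) (q w)) ->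
  px q z = py p z.
Proof.
  intros hz Hp Hq Hu. set (f := fun x y => u (x, y)).
  assert (loc := disk_locally_2d z hz).
  assert (nx : forall x y, Cmod (x, y) < 1 -> locally x (fun t =>
     Derive (fun s => f t s) y = q (t, y))).
  { intros x y h. generalize (locally_2d_1d_const_y _ _ _ (disk_locally_2d (x, y) h)).
    apply filter_imp. intros t ht. apply is_derive_unique.
    exact (proj2 (Hu (t, y) ht)). }
  assert (ny : forall x y, Cmod (x, y) < 1 -> locally y (fun t =>
     Derive (fun s => f s t) x = p (x, t))).
  { intros x y h. generalize (locally_2d_1d_const_x _ _ _ (disk_locally_2d (x, y) h)).
    apply filter_imp. intros t ht. apply is_derive_unique.
    exact (proj1 (Hu (x, t) ht)). }
  assert (dx : forall x y, Cmod (x, y) < 1 ->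
     Derive (fun t => Derive (fun s => f t s) y) x = px q (x, y)).
  { intros x y h. apply (Derive_ext_loc _ (fun t => q (t, y))). now apply nx. }
  assert (dy : forall x y, Cmod (x, y) < 1 ->
     Derive (fun t => Derive (fun s => f s t) x) y = py p (x, y)).
  { intros x y h. apply (Derive_ext_loc _ (fun t => p (x, t))). now apply ny. }
  assert (S := Schwarz f (fst z) (snd z)).
  rewrite dx, dy in S by (rewrite <- surjective_pairing; exact hz).
  rewrite <- surjective_pairing in S. apply S.
  - generalize loc. apply locally_2d_impl, locally_2d_forall. intros x y h.
    destruct (Hu (x, y) h) as [a b]. repeat split.
    + eexists. exact a.
    + eexists. exact b.
    + apply (ex_derive_ext_loc (fun t => q (t, y))).
      * generalize (nx x y h). apply filter_imp. intros t e. now rewrite e.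
      * now destruct (Hq (x, y) h).
    + apply (ex_derive_ext_loc (fun t => p (x, t))).
      * generalize (ny x y h). apply filter_imp. intros t e. now rewrite e.
      * now destruct (Hp (x, y) h).
  - apply continuity_2d_pt_ext_loc with (fun x y => px q (x, y)).
    + generalize loc. apply locally_2d_impl, locally_2d_forall. intros x y h.
      now rewrite <- dx.
    + apply C1_continuity_2d. now destruct (Hq z hz).
  - apply continuity_2d_pt_ext_loc with (fun x y => py p (x, y)).
    + generalize loc. apply locally_2d_impl, locally_2d_forall. intros x y h.
      now rewrite <- dy.
    + apply C1_continuity_2d. now destruct (Hp z hz).
Qed.

Lemma cderiv_partials f z l : cderiv f z l ->
  (is_derive (fun t => fst (f (t, snd z))) (fst z) (fst l) /\
   is_derive (fun t => fst (f (fst z, t))) (snd z) (- snd l)) /\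
  (is_derive (fun t => snd (f (t, snd z))) (fst z) (snd l) /\
   is_derive (fun t => snd (f (fst z, t))) (snd z) (fst l)).
Proof.
  intros H. rewrite (surjective_pairing z) in H.
  destruct (cderiv_curve f (fun t => t) (fun _ => snd z) (fst z) 1 0 l H) as [a b].
  { apply (is_derive_id (K := R_AbsRing)). }
  { apply (is_derive_const (V := R_NormedModule)). }
  destruct (cderiv_curve f (fun _ => fst z) (fun t => t) (snd z) 0 1 l H) as [c d].
  { apply (is_derive_const (V := R_NormedModule)). }
  { apply (is_derive_id (K := R_AbsRing)). }
  split; split;
    [refine (eq_ind _ (is_derive _ _) a _ _) | refine (eq_ind _ (is_derive _ _) c _ _)
    |refine (eq_ind _ (is_derive _ _) b _ _) | refine (eq_ind _ (is_derive _ _) d _ _)];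
    simpl; ring.
Qed.

Lemma C1_on_disk_opp u : C1_on_disk u -> C1_on_disk (fun z => - u z).
Proof.
  intros H z hz. destruct (H z hz) as [a b c d].
  assert (ex : forall w, px (fun z => - u z) w = - px u w) by (intros w; apply Derive_opp).
  assert (ey : forall w, py (fun z => - u z) w = - py u w) by (intros w; apply Derive_opp).
  split.
  - exact (ex_derive_opp (V := R_NormedModule) _ _ a).
  - exact (ex_derive_opp (V := R_NormedModule) _ _ b).
  - apply continuous_ext with (fun w => opp (px u w)); [intros w; now rewrite ex|].
    now apply (continuous_opp (V := R_NormedModule)).
  - apply continuous_ext with (fun w => opp (py u w)); [intros w; now rewrite ey|].
    now apply (continuous_opp (V := R_NormedModule)).
Qed.

Lemma differentiable_cderiv f z l :
  differentiable_pt_lim (fun x y => fst (f (x, y))) (fst z) (snd z) (fst l) (- snd l) ->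
  differentiable_pt_lim (fun x y => snd (f (x, y))) (fst z) (snd z) (snd l) (fst l) ->
  cderiv f z l.
Proof.
  intros H1 H2. apply cderiv_intro. intros eps he.
  assert (hp : 0 < eps / 2) by lra.
  destruct (locally_2d_and _ _ _ _ (H1 (mkposreal _ hp)) (H2 (mkposreal _ hp))) as [d Hd].
  exists d. split; [apply cond_pos|]. intros w hw.
  assert (a1 := fst_le_Cmod (w - z)). assert (a2 := snd_le_Cmod (w - z)).
  simpl in a1, a2.
  change (fst w + - fst z) with (fst w - fst z) in a1.
  change (snd w + - snd z) with (snd w - snd z) in a2.
  destruct (Hd (fst w) (snd w)) as [b1 b2]; [lra | lra |].
  rewrite <- !surjective_pairing in b1, b2. simpl in b1, b2.
  assert (M : Rmax (Rabs (fst w - fst z)) (Rabs (snd w - snd z)) <= Cmod (w - z))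
    by (apply Rmax_lub; lra).
  refine (Rle_trans _ _ _ (Cmod_le_abs _) _).
  replace (fst (f w - f z - l * (w - z))%C) with
    (fst (f w) - fst (f z) - (fst l * (fst w - fst z) + - snd l * (snd w - snd z)))
    by (simpl; ring).
  replace (snd (f w - f z - l * (w - z))%C) with
    (snd (f w) - snd (f z) - (snd l * (fst w - fst z) + fst l * (snd w - snd z)))
    by (simpl; ring).
  nra.
Qed.

Lemma continuous_pair_ccont (a b : C -> R) z :
  Coquelicot.Continuity.continuous a z -> Coquelicot.Continuity.continuous b z ->
  ccont (fun w => (a w, b w)) z.
Proof.
  intros Ha Hb eps he. assert (hp : 0 < eps / 2) by lra.
  destruct (locally_2d_and _ _ _ _ (C1_continuity_2d _ _ Ha (mkposreal _ hp))
    (C1_continuity_2d _ _ Hb (mkposreal _ hp))) as [d Hd].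
  exists d. split; [apply cond_pos|]. intros w hw.
  assert (a1 := fst_le_Cmod (w - z)). assert (a2 := snd_le_Cmod (w - z)).
  simpl in a1, a2.
  change (fst w + - fst z) with (fst w - fst z) in a1.
  change (snd w + - snd z) with (snd w - snd z) in a2.
  destruct (Hd (fst w) (snd w)) as [b1 b2]; [lra | lra |].
  rewrite <- !surjective_pairing in b1, b2. simpl in b1, b2.
  refine (Rle_lt_trans _ _ _ (Cmod_le_abs _) _). simpl.
  unfold Rminus in *. lra.
Qed.

(* The Cauchy-Riemann equations for [h' = p] are the equality of the mixed
   partial derivatives of the real and imaginary parts of [h]. *)
Lemma C1_derivative_holo h p :
  (forall z, Cmod z < 1 -> cderiv h z (p z)) ->
  C1_on_disk (re_part p) -> C1_on_disk (im_part p) ->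
  forall z, Cmod z < 1 -> holo_at p z.
Proof.
  intros Hh Hr Hi.
  assert (cr1 : forall z, Cmod z < 1 -> py (re_part p) z = - px (im_part p) z).
  { intros z hz. rewrite <- (mixed_partials (fun z => fst (h z)) (re_part p)
      (fun z => - im_part p z) z); auto using C1_on_disk_opp.
    - apply Derive_opp.
    - intros w hw. exact (proj1 (cderiv_partials _ _ _ (Hh w hw))). }
  assert (cr2 : forall z, Cmod z < 1 -> px (re_part p) z = py (im_part p) z).
  { intros z hz. apply (mixed_partials (fun z => snd (h z))); auto.
    intros w hw. exact (proj2 (cderiv_partials _ _ _ (Hh w hw))). }
  intros z hz. exists (fun w => (px (re_part p) w, px (im_part p) w)), (1 - Cmod z).
  split; [lra|]. intros w hw.
  assert (hw1 : Cmod w < 1).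
  { assert (T := Cmod_triangle_inv w z). lra. }
  split.
  - apply differentiable_cderiv; simpl.
    + rewrite <- cr1 by exact hw1. exact (C1_differentiable _ _ Hr hw1).
    + rewrite cr2 by exact hw1. exact (C1_differentiable _ _ Hi hw1).
  - destruct (Hr w hw1). destruct (Hi w hw1). now apply continuous_pair_ccont.
Qed.

(** The shape matches the components of the Wirtinger derivatives as written in [dz_pair] and
    [Cconj_dzbar_pair]. *)
Lemma C1_on_disk_lin (a : R) u v : C1_on_disk u -> C1_on_disk v ->
  C1_on_disk (fun z => a * (u z + v z)).
Proof.
  intros Hu Hv.
  assert (ex : forall w, Cmod w < 1 ->
    px (fun z => a * (u z + v z)) w = a * (px u w + px v w)).
  { intros w hw. destruct (Hu w hw), (Hv w hw). unfold px.
    rewrite Derive_scal, Derive_plus; auto. }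
  assert (ey : forall w, Cmod w < 1 ->
    py (fun z => a * (u z + v z)) w = a * (py u w + py v w)).
  { intros w hw. destruct (Hu w hw), (Hv w hw). unfold py.
    rewrite Derive_scal, Derive_plus; auto. }
  intros z hz.
  assert (loc : locally z (fun w : C => Cmod w < 1)).
  { generalize (proj1 (locally_2d_locally _ _ _) (disk_locally_2d z hz)).
    rewrite <- surjective_pairing. apply filter_imp. intros w.
    now rewrite <- surjective_pairing. }
  destruct (Hu z hz) as [a1 b1 c1 d1], (Hv z hz) as [a2 b2 c2 d2].
  split.
  - apply (ex_derive_scal (fun t => u (t, snd z) + v (t, snd z))).
    now apply (ex_derive_plus (V := R_NormedModule)).
  - apply (ex_derive_scal (fun t => u (fst z, t) + v (fst z, t))).
    now apply (ex_derive_plus (V := R_NormedModule)).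
  - apply continuous_ext_loc with (fun w => scal a (plus (px u w) (px v w))).
    + generalize loc. apply filter_imp. intros w hw. now rewrite ex.
    + apply (continuous_scal_r (V := R_NormedModule)).
      now apply (continuous_plus (V := R_NormedModule)).
  - apply continuous_ext_loc with (fun w => scal a (plus (py u w) (py v w))).
    + generalize loc. apply filter_imp. intros w hw. now rewrite ey.
    + apply (continuous_scal_r (V := R_NormedModule)).
      now apply (continuous_plus (V := R_NormedModule)).
Qed.

Lemma C1_on_disk_ext u v : (forall z, u z = v z) -> C1_on_disk u -> C1_on_disk v.
Proof.
  intros E H. replace v with u; [exact H|]. now apply FunctionalExtensionality.functional_extensionality.
Qed.

Lemma dz_pair f z : dz f z =
  (1 / 2 * (px (re_part f) z + py (im_part f) z),
   1 / 2 * (px (im_part f) z + - py (re_part f) z)).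
Proof. unfold dz, fx, fy. apply injective_projections; simpl; field. Qed.

Lemma Cconj_dzbar_pair f z : Cconj (dzbar f z) =
  (1 / 2 * (px (re_part f) z + - py (im_part f) z),
   - (1 / 2) * (px (im_part f) z + py (re_part f) z)).
Proof. unfold dzbar, fx, fy. apply injective_projections; simpl; field. Qed.

Lemma Wirtinger_harmonic f h g z l k :
  (forall w, Cmod w < 1 -> f w = (h w + Cconj (g w))%C) -> Cmod z < 1 ->
  cderiv h z l -> cderiv g z k -> dz f z = l /\ Cconj (dzbar f z) = k.
Proof.
  intros E hz Hh Hg.
  destruct (cderiv_partials _ _ _ Hh) as [[a1 a2] [a3 a4]].
  destruct (cderiv_partials _ _ _ Hg) as [[b1 b2] [b3 b4]].
  assert (nx : locally (fst z) (fun t => Cmod (t, snd z) < 1))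
    by exact (locally_2d_1d_const_y _ _ _ (disk_locally_2d z hz)).
  assert (ny : locally (snd z) (fun t => Cmod (fst z, t) < 1))
    by exact (locally_2d_1d_const_x _ _ _ (disk_locally_2d z hz)).
  assert (e1 : px (re_part f) z = fst l + fst k).
  { apply is_derive_unique. eapply is_derive_ext_loc;
      [|exact (is_derive_plus (V := R_NormedModule) _ _ _ _ _ a1 b1)].
    generalize nx. apply filter_imp. intros t ht. unfold re_part. now rewrite E. }
  assert (e2 : py (re_part f) z = - snd l + - snd k).
  { apply is_derive_unique. eapply is_derive_ext_loc;
      [|exact (is_derive_plus (V := R_NormedModule) _ _ _ _ _ a2 b2)].
    generalize ny. apply filter_imp. intros t ht. unfold re_part. now rewrite E. }
  assert (e3 : px (im_part f) z = snd l - snd k).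
  { apply is_derive_unique. eapply is_derive_ext_loc;
      [|exact (is_derive_minus (V := R_NormedModule) _ _ _ _ _ a3 b3)].
    generalize nx. apply filter_imp. intros t ht. unfold im_part. now rewrite E. }
  assert (e4 : py (im_part f) z = fst l - fst k).
  { apply is_derive_unique. eapply is_derive_ext_loc;
      [|exact (is_derive_minus (V := R_NormedModule) _ _ _ _ _ a4 b4)].
    generalize ny. apply filter_imp. intros t ht. unfold im_part. now rewrite E. }
  rewrite dz_pair, Cconj_dzbar_pair, e1, e2, e3, e4.
  split; apply injective_projections; simpl; field.
Qed.

(** The derivatives h' and g' are the Wirtinger derivatives of [f], hence have C^1 components
    because [f] is C^2. This makes them holomorphic without Cauchy's theorem. *)
Lemma Wirtinger_holo f h g : harmonic_on_disk f ->
  analytic_on_disk h -> analytic_on_disk g ->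
  (forall z, Cmod z < 1 -> f z = (h z + Cconj (g z))%C) ->
  forall z, Cmod z < 1 ->
  (cderiv h z (dz f z) /\ holo_at (dz f) z) /\
  (cderiv g z (Cconj (dzbar f z)) /\ holo_at (fun w => Cconj (dzbar f w)) z).
Proof.
  intros [[_ rx ry] [_ ix iy] _] Hh Hg E.
  assert (dh : forall z, Cmod z < 1 -> cderiv h z (dz f z) /\ cderiv g z (Cconj (dzbar f z))).
  { intros z hz. destruct (ex_derive_cderiv _ _ (Hh z hz)) as [l Hl].
    destruct (ex_derive_cderiv _ _ (Hg z hz)) as [k Hk].
    now destruct (Wirtinger_harmonic f h g z l k E hz Hl Hk) as [-> ->]. }
  intros z hz. destruct (dh z hz). repeat split; auto.
  - apply (C1_derivative_holo h); auto; [intros; now apply dh | |].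
    + eapply C1_on_disk_ext; [|exact (C1_on_disk_lin (1 / 2) _ _ rx iy)].
      intros w. unfold re_part at 2. now rewrite dz_pair.
    + eapply C1_on_disk_ext; [|exact (C1_on_disk_lin (1 / 2) _ _ ix (C1_on_disk_opp _ ry))].
      intros w. unfold im_part at 2. now rewrite dz_pair.
  - apply (C1_derivative_holo g (fun w => Cconj (dzbar f w))); auto; [intros; now apply dh | |].
    + eapply C1_on_disk_ext; [|exact (C1_on_disk_lin (1 / 2) _ _ rx (C1_on_disk_opp _ iy))].
      intros w. unfold re_part at 2. now rewrite Cconj_dzbar_pair.
    + eapply C1_on_disk_ext; [|exact (C1_on_disk_lin (- (1 / 2)) _ _ ix ry)].
      intros w. unfold im_part at 2. now rewrite Cconj_dzbar_pair.
Qed.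

(** * Ellipticity at every point *)

(** The equation says z^2 = conj c. The direction of conj (1 + c) bisects the angle between 1 and
    conj c; for c = -1 it degenerates and z = i is taken. Such a [z] is a direction in which a
    differential attains its norm. *)
Lemma conj_quotient_unit (c : C) : Cmod c = 1 ->
  exists z, Cmod z = 1 /\ Cconj z = (c * z)%C.
Proof.
  intros hc. destruct (Ceq_dec (1 + c)%C 0) as [E|hn].
  - exists Ci. split; [apply Cmod_Ci|].
    replace c with ((1 + c) - 1)%C by ring. rewrite E.
    apply injective_projections; simpl; ring.
  - assert (hp := Cmod_pos _ hn). set (r := / Cmod (1 + c)).
    exists (Cconj (1 + c) * RtoC r)%C. split.
    + rewrite Cmod_mult, Cmod_conj, Cmod_R, Rabs_right.
      * unfold r. field. lra.
      * left. now apply Rinv_0_lt_compat.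
    + assert (E : (c * Cconj c)%C = RtoC 1) by (rewrite <- Cmod2_conj, hc; f_equal; ring).
      rewrite Cmult_conj, Cconj_conj, Cplus_conj.
      replace (Cconj (RtoC r)) with (RtoC r)
        by (apply injective_projections; simpl; ring).
      replace (Cconj (RtoC 1)) with (RtoC 1) by (apply injective_projections; simpl; ring).
      replace (c * ((1 + Cconj c) * r))%C with ((c + c * Cconj c) * r)%C by ring.
      rewrite E. ring.
Qed.

Module Ellipticity.
Import all_boot all_order all_algebra all_classical all_reals all_analysis.
Import Rstruct Rstruct_topology.
Delimit Scope R_scope with coqR.
Local Open Scope classical_set_scope.
Local Open Scope R_scope.
Local Notation Cm := Coquelicot.Complex.Cmod.

Lemma mx_app_jacobian f z w : mx_app (jacobian_mx f z) w =
  Cplus (Cmult (dz f z) w) (Cmult (dzbar f z) (Cconj w)).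
Proof.
rewrite /mx_app /jacobian_mx !mxE /=.
rewrite /dz /dzbar /fx /fy; apply: injective_projections => /=; field.
Qed.

(** The differential sends w to f_z w + f_zbar conj w. For the unit [w] with conj w = c w, [c]
    aligning f_zbar with f_z, the two terms add up without cancellation. *)
Lemma mx_opnorm_jacobian f z : Cm (dz f z) + Cm (dzbar f z) <= mx_opnorm (jacobian_mx f z).
Proof.
have [c [hc E]] := align_unit (dz f z) (dzbar f z).
have [w [hw Ew]] := conj_quotient_unit c hc.
rewrite -E; apply/RleP; apply: ub_le_sup.
(* Boundedness has to be shown first: an unbounded set would get a default supremum. *)
- exists (Cm (dz f z) + Cm (dzbar f z))%coqR => _ [v /= hv <-].
  apply/RleP; rewrite mx_app_jacobian.
  apply: Rle_trans (Cmod_triangle _ _) _.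
  by rewrite !Cmod_mult Cmod_conj hv; right; ring.
- exists w => //; rewrite mx_app_jacobian Ew.
  have -> : Cplus (Cmult (dz f z) w) (Cmult (dzbar f z) (Cmult c w)) =
      Cmult (Cplus (dz f z) (Cmult c (dzbar f z))) w by ring.
  by rewrite Cmod_mult hw; ring.
Qed.

Lemma ae_on_disk_impl (P Q : C -> Prop) :
  (forall z, Cm z < 1 -> P z -> Q z) -> ae_on_disk P -> ae_on_disk Q.
Proof.
move=> PQ [A [mA A0 HA]]; exists A; split => //.
apply: subset_trans HA => z /= h h'; apply: h => hz; apply: PQ => //; exact: h'.
Qed.

End Ellipticity.

(** A set of full measure is dense, so an inequality between continuous functions that holds almost
    everywhere holds everywhere. *)
Lemma ae_on_disk_ge0 (Phi : C -> C) z :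
  ccont Phi z -> Cmod z < 1 -> ae_on_disk (fun w => 0 <= fst (Phi w)) ->
  0 <= fst (Phi z).
Proof.
  intros hc hz hae. apply Rnot_lt_le. intros hlt.
  destruct (hc (- fst (Phi z))) as [d [hd Hd]]; [lra|].
  assert (hm : 0 < Rmin d (1 - Cmod z)) by (apply Rmin_pos; lra).
  assert (m1 := Rmin_l d (1 - Cmod z)). assert (m2 := Rmin_r d (1 - Cmod z)).
  destruct (PlaneTopology.ae_on_disk_dense _ z _ hae hm) as [w [hw H]].
  { intros w hw. assert (T := Cmod_triangle_inv w z). lra. }
  specialize (Hd w ltac:(lra)). assert (L := fst_le_Cmod (Phi w - Phi z)).
  assert (L' := Rle_abs (fst (Phi w - Phi z)%C)). simpl in L, L'. lra.
Qed.

Lemma ccont_Cmod f z : ccont f z -> ccont (fun w => RtoC (Cmod (f w))) z.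
Proof.
  intros H eps he. destruct (H eps he) as [d [hd Hd]]. exists d. split; [exact hd|].
  intros w hw. specialize (Hd w hw). rewrite <- RtoC_minus, Cmod_R.
  assert (T1 := Cmod_triangle_inv (f w) (f z)).
  assert (T2 := Cmod_triangle_inv (f z) (f w)). rewrite Cmod_minus_sym in T2.
  apply Rabs_def1; lra.
Qed.

(** Both conclusions compare continuous functions of |f_z| and |f_zbar|. The first extends the sign
    of the Jacobian, the second the ellipticity inequality with the norm of the differential
    replaced by its lower bound. *)
Lemma elliptic_pointwise K K' f : elliptic K K' f ->
  (forall z, Cmod z < 1 -> ccont (dz f) z /\ ccont (fun w => Cconj (dzbar f w)) z) ->
  forall z, Cmod z < 1 ->
  Cmod (Cconj (dzbar f z)) <= Cmod (dz f z) /\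
  (Cmod (dz f z) + Cmod (Cconj (dzbar f z))) ^ 2 <=
    K * (Cmod (dz f z) ^ 2 - Cmod (Cconj (dzbar f z)) ^ 2) + K'.
Proof.
  intros [hsp _ _ _ hell] hc z hz. destruct (hc z hz) as [hp hq].
  set (p := fun w => RtoC (Cmod (dz f w))).
  set (q := fun w => RtoC (Cmod (Cconj (dzbar f w)))).
  assert (cp : ccont p z) by now apply ccont_Cmod.
  assert (cq : ccont q z) by exact (ccont_Cmod _ _ hq).
  assert (cJ : ccont (fun w => p w * p w + - (q w * q w))%C z).
  { apply ccont_plus; [now apply ccont_mult|]. apply ccont_opp. now apply ccont_mult. }
  assert (g0 := Cmod_ge_0 (dz f z)). assert (g1 := Cmod_ge_0 (dzbar f z)).
  split.
  - assert (J : 0 <= fst (p z * p z + - (q z * q z))%C).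
    { apply (ae_on_disk_ge0 (fun w => p w * p w + - (q w * q w))%C); auto.
      revert hsp. apply Ellipticity.ae_on_disk_impl. intros w _ h.
      unfold jacobian in h. unfold p, q. rewrite Cmod_conj. simpl. lra. }
    unfold p, q in J. rewrite Cmod_conj in *. simpl in J. nra.
  - assert (J : 0 <= fst (K * (p z * p z + - (q z * q z)) + K'
                          + - ((p z + q z) * (p z + q z)))%C).
    { apply (ae_on_disk_ge0 (fun w => K * (p w * p w + - (q w * q w)) + K'
                          + - ((p w + q w) * (p w + q w)))%C); auto.
      - apply ccont_plus.
        + apply ccont_plus; [|apply ccont_const].
          apply ccont_mult; [apply ccont_const | exact cJ].
        + apply ccont_opp, ccont_mult; now apply ccont_plus.
      - revert hell. apply Ellipticity.ae_on_disk_impl. intros w _ h.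
        assert (O := Ellipticity.mx_opnorm_jacobian f w).
        assert (n0 := Cmod_ge_0 (dz f w)). assert (n1 := Cmod_ge_0 (dzbar f w)).
        unfold jacobian in h. unfold p, q. rewrite Cmod_conj. simpl.
        set (o := mx_opnorm (jacobian_mx f w)) in *.
        assert ((Cmod (dz f w) + Cmod (dzbar f w)) ^ 2 <= o ^ 2) by (apply pow_incr; lra).
        lra. }
    unfold p, q in J. simpl in J. lra.
Qed.

(** * The radius of the univalent disk *)

Lemma landau_radius_lt m rho : 0 < m -> 0 <= rho < / (1 + m) ->
  rho < 1 /\ m * (rho / (1 - rho)) < 1.
Proof.
  intros hm hr. assert (h : rho * (1 + m) < 1).
  { apply Rmult_lt_reg_r with (/ (1 + m)); [apply Rinv_0_lt_compat; lra|].
    rewrite Rmult_assoc, Rinv_r by lra. lra. }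
  assert (h1 : rho < 1) by nra. split; [exact h1|].
  apply Rmult_lt_reg_r with (1 - rho); [lra|].
  replace (m * (rho / (1 - rho)) * (1 - rho)) with (m * rho) by (field; lra). nra.
Qed.

(** The covering radius is continuous in [rho] and takes the value 1 + m ln (m / (1 + m)) at rho = 1
    / (1 + m), so anything smaller is exceeded slightly below that radius. *)
Lemma landau_radius_approx m x : 0 < m -> x < 1 + m * ln (m / (1 + m)) ->
  exists rho, 0 <= rho < / (1 + m) /\ x <= (1 + m) * rho + m * ln (1 - rho).
Proof.
  intros hm hx. set (r0 := / (1 + m)).
  assert (hr0 : 0 < r0) by (apply Rinv_0_lt_compat; lra).
  assert (E1 : 1 - r0 = m / (1 + m)) by (unfold r0; field; lra).
  assert (E2 : (1 + m) * r0 = 1) by (unfold r0; field; lra).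
  assert (hq : 0 < m / (1 + m)) by (apply Rdiv_lt_0_compat; lra).
  assert (C : continuity_pt (fun r => (1 + m) * r + m * ln (1 - r)) r0).
  { apply derivable_continuous_pt. eexists. apply is_derive_Reals.
    auto_derive; [lra | reflexivity]. }
  destruct (C (1 + m * ln (m / (1 + m)) - x)) as [d [hd Hd]]; [lra|].
  set (e := Rmin d r0 / 2).
  assert (he : 0 < Rmin d r0) by (apply Rmin_pos; lra).
  assert (m1 := Rmin_l d r0). assert (m2 := Rmin_r d r0).
  exists (r0 - e). unfold e. split; [lra|].
  specialize (Hd (r0 - e)). simpl in Hd. unfold R_dist in Hd.
  rewrite E1, E2 in Hd. unfold e in Hd.
  assert (B : Rabs ((1 + m) * (r0 - Rmin d r0 / 2) + m * ln (1 - (r0 - Rmin d r0 / 2))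
     - (1 + m * ln (m / (1 + m)))) < 1 + m * ln (m / (1 + m)) - x).
  { apply Hd. split; [split; [exact I | lra]|].
    replace (r0 - Rmin d r0 / 2 - r0) with (- (Rmin d r0 / 2)) by ring.
    rewrite Rabs_Ropp, Rabs_right; lra. }
  apply Rabs_def2 in B. lra.
Qed.

(** At the radius 1 / (1 + m) itself the contraction constant is 1. Each claim about the open disks
    is therefore settled at some smaller [rho] depending on the points involved. *)
Lemma landau_disk (H G H' G' : C -> C) m : 0 < m ->
  (forall z, Cmod z < 1 -> cderiv H z (H' z)) ->
  (forall z, Cmod z < 1 -> cderiv G z (G' z)) ->
  1 <= Cmod (H' 0) - Cmod (G' 0) ->
  (forall z, Cmod z < 1 ->
    Cmod (H' z - H' 0) + Cmod (G' z - G' 0) <= m * (Cmod z / (1 - Cmod z))) ->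
  let F z := (H z + Cconj (G z))%C in
  let r0 := / (1 + m) in
  let R0 := 1 + m * ln (m / (1 + m)) in
  (forall x y, Cmod x < r0 -> Cmod y < r0 -> F x = F y -> x = y) /\
  (forall w, Cmod (w - F 0) < R0 -> exists x, Cmod x < r0 /\ F x = w) /\
  (forall x, Cmod x < r0 -> Cmod (F x - F 0) < R0 ->
     forall eps, 0 < eps -> exists d, 0 < d /\ forall y, Cmod y < r0 ->
       Cmod (F y - F x) < d -> Cmod (y - x) < eps).
Proof.
  intros hm dH dG h1 var F r0 R0.
  assert (expand := landau_expand H G H' G' m hm dH dG h1 var).
  assert (cover := landau_cover H G H' G' m hm dH dG h1 var).
  cbv zeta in expand, cover. fold F in expand, cover.
  change (forall rho z1 z2, 0 <= rho < 1 -> Cmod z1 <= rho -> Cmod z2 <= rho ->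
    (1 - m * (rho / (1 - rho))) * Cmod (z2 - z1) <= Cmod (F z2 - F z1)) in expand.
  change (forall rho w, 0 <= rho -> m * (rho / (1 - rho)) < 1 -> rho < 1 ->
    Cmod w <= (1 + m) * rho + m * ln (1 - rho) ->
    exists z, Cmod z <= rho /\ F z = (F 0 + w)%C) in cover.
  assert (inj : forall x y, Cmod x < r0 -> Cmod y < r0 -> F x = F y -> x = y).
  { intros x y hx hy E. set (rho := Rmax (Cmod x) (Cmod y)).
    assert (m1 := Rmax_l (Cmod x) (Cmod y)). assert (m2 := Rmax_r (Cmod x) (Cmod y)).
    fold rho in m1, m2. assert (hr : 0 <= rho < r0).
    { split; [generalize (Cmod_ge_0 x); lra | now apply Rmax_lub_lt]. }
    destruct (landau_radius_lt m rho hm hr) as [hr1 hk].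
    assert (B := expand rho y x ltac:(lra) m2 m1). rewrite E, Cmod_minus_diag in B.
    assert (p := Cmod_ge_0 (x - y)). assert (Z : Cmod (x - y) = 0) by nra.
    apply Cmod_eq_0 in Z. replace x with ((x - y) + y)%C by ring. rewrite Z. ring. }
  assert (surj : forall rho w, 0 <= rho < r0 ->
    Cmod (w - F 0) <= (1 + m) * rho + m * ln (1 - rho) ->
    exists x, Cmod x <= rho /\ F x = w).
  { intros rho w hr hw. destruct (landau_radius_lt m rho hm hr) as [hr1 hk].
    destruct (cover rho (w - F 0)%C ltac:(lra) hk hr1 hw) as [z [hz Hz]].
    exists z. split; [exact hz|]. rewrite Hz. ring. }
  split; [exact inj | split].
  - intros w hw. destruct (landau_radius_approx m _ hm hw) as [rho [hr hle]].
    fold r0 in hr.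
    destruct (surj rho w hr hle) as [x [hx E]]. exists x. split; [lra | exact E].
  (* The intermediate radius [t] gives one [rho], hence one expansion constant [k], valid at [x] and
     at every [y] whose image is close to [F x]. *)
  - intros x hx hFx eps he. set (t := (Cmod (F x - F 0) + R0) / 2).
    destruct (landau_radius_approx m t hm) as [rho [hr hle]]; [unfold t, R0 in *; lra|].
    fold r0 in hr.
    destruct (landau_radius_lt m rho hm hr) as [hr1 hk].
    (* The value [F y] is already attained on the disk of radius [rho], and by injectivity only at
       [y]. *)
    assert (small : forall y, Cmod y < r0 -> Cmod (F y - F 0) <= t -> Cmod y <= rho).
    { intros y hy hFy. destruct (surj rho (F y) hr ltac:(lra)) as [y' [hy' E]].
      rewrite <- (inj y' y); auto. lra. }
    set (k := 1 - m * (rho / (1 - rho))) in *. assert (hk0 : 0 < k) by (unfold k; lra).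
    exists (Rmin (t - Cmod (F x - F 0)) (k * eps)). split.
    + apply Rmin_pos; [unfold t; lra | now apply Rmult_lt_0_compat].
    + intros y hy hFy.
      assert (m1 := Rmin_l (t - Cmod (F x - F 0)) (k * eps)).
      assert (m2 := Rmin_r (t - Cmod (F x - F 0)) (k * eps)).
      assert (T := Cmod_triang_minus (F y) (F x) (F 0%C)).
      assert (B := expand rho x y ltac:(lra) (small x hx ltac:(unfold t; lra))
                     (small y hy ltac:(lra))). fold k in B.
      apply Rmult_lt_reg_l with k; [exact hk0 | lra].
Qed.

Lemma landau_radius_pos m : 0 < m -> 0 < 1 + m * ln (m / (1 + m)).
Proof.
  intros hm. assert (hq : 0 < / m) by now apply Rinv_0_lt_compat.
  replace (m / (1 + m)) with (/ (1 + / m)) by (field; lra).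
  rewrite ln_Rinv by lra.
  assert (E := exp_ineq1 (/ m) ltac:(lra)).
  assert (L : ln (1 + / m) < / m).
  { rewrite <- (ln_exp (/ m)) at 2. apply ln_increasing; lra. }
  assert (m * ln (1 + / m) < m * / m) by now apply Rmult_lt_compat_l.
  rewrite Rinv_r in H by lra. lra.
Qed.

(** Rationalising, (S - K) (S + K) = 4 K' with S the square root, so (4 K' - 1) / L = L - 2 K -
    1/L. *)
Lemma rho1_landau K K' : 1 <= K -> 0 <= K' ->
  let L := K + sqrt (K ^ 2 + 4 * K') in let m := L - / L in
  0 < m /\ rho1 K K' = (1 + m * ln (m / (1 + m))) / sqrt 2.
Proof.
  intros hK hK' L m. set (S := sqrt (K ^ 2 + 4 * K')) in *.
  assert (hS : S * S = K ^ 2 + 4 * K') by (apply sqrt_sqrt; nra).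
  assert (S0 : 0 <= S) by apply sqrt_pos.
  assert (hs := Rlt_sqrt2_0). assert (SK : K <= S) by nra.
  assert (hL : 2 <= L) by (unfold L; lra).
  assert (iL : / L <= / 2) by (apply Rinv_le_contravar; lra).
  assert (hm : 0 < m) by (unfold m; lra). split; [exact hm|].
  assert (E : (4 * K' - 1) / L = S - K - / L).
  { replace (4 * K' - 1) with ((S - K) * L - 1) by (unfold L; nra). field. lra. }
  unfold rho1. fold S. fold L.
  replace (2 * K + (4 * K' - 1) / L) with m by (rewrite E; unfold m, L; ring).
  replace (1 + 2 * K + (4 * K' - 1) / L) with (1 + m) by (rewrite E; unfold m, L; ring).
  replace ((4 * K' - 1) / (sqrt 2 * L)) with ((4 * K' - 1) / L / sqrt 2) by (field; lra).
  rewrite E. assert (s2 := sqrt_sqrt 2 ltac:(lra)).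
  replace (sqrt 2 * K) with (2 * K / sqrt 2).
  2:{ rewrite <- s2 at 1. field. lra. }
  unfold m, L. field. split; [lra|]. fold L. lra.
Qed.

(** Here [X] and [l] stand for Lambda and lambda of the normalised map, and [c] for the squared
    conformal factor that multiplies K'. The bound is the larger root of X^2 = 2 K X + 4 K'. *)
Lemma elliptic_bound K K' X l c : 1 <= K -> 0 <= K' -> 0 <= X -> 0 <= c <= 4 ->
  l <= 2 -> X ^ 2 <= K * X * l + K' * c ->
  X <= K + sqrt (K ^ 2 + 4 * K').
Proof.
  intros hK hK' hX hc hl h. set (S := sqrt (K ^ 2 + 4 * K')).
  assert (hS : S * S = K ^ 2 + 4 * K') by (apply sqrt_sqrt; nra).
  assert (S0 : 0 <= S) by apply sqrt_pos.
  assert (K * X * l <= K * X * 2) by (apply Rmult_le_compat_l; nra).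
  assert (K' * c <= K' * 4) by (apply Rmult_le_compat_l; lra).
  assert ((X - K) * (X - K) <= S * S) by (rewrite hS; nra).
  apply Rnot_lt_le. intros hlt. nra.
Qed.

(** * The extremal point *)

Lemma Cmod_scal (k : R) (z : C) : 0 <= k -> Cmod (RtoC k * z) = k * Cmod z.
Proof. intros hk. now rewrite Cmod_mult, Cmod_R, Rabs_right by lra. Qed.

Lemma cderiv_scal (c : C) f z l : cderiv f z l -> cderiv (fun w => c * f w)%C z (c * l)%C.
Proof.
  intros H. replace (c * l)%C with (0 * f z + c * l)%C by ring.
  apply (cderiv_mult (fun _ => c)); auto using cderiv_const.
Qed.

(* The chart is [Phi x = r mobius (a / r) (x / sqrt 2)]. *)
Lemma mobius_chart r a : 0 < r -> Cmod a < r ->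
  exists Phi dPhi Psi : C -> C,
  Phi 0%C = a /\
  (forall x, Cmod x < 1 -> Cmod (Phi x) < r /\ cderiv Phi x (dPhi x) /\ holo_at Phi x
     /\ holo_at dPhi x
     /\ Cmod (dPhi x) * (1 - Cmod x ^ 2 / 2) = (r ^ 2 - Cmod (Phi x) ^ 2) / (sqrt 2 * r)) /\
  (forall x, Cmod x < 1 -> Psi (Phi x) = x) /\
  (forall z, Cmod z < r -> Phi (Psi z) = z /\ ccont Psi z).
Proof.
  intros hr ha. set (s := sqrt 2).
  assert (ss : s * s = 2) by (apply sqrt_sqrt; lra).
  assert (s0 : 0 < s) by apply Rlt_sqrt2_0. assert (s1 : 1 < s) by nra.
  assert (is : 0 < / s < 1).
  { split; [now apply Rinv_0_lt_compat|]. rewrite <- Rinv_1. apply Rinv_lt_contravar; lra. }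
  assert (ir : 0 < / r) by now apply Rinv_0_lt_compat.
  assert (a0 := Cmod_ge_0 a).
  assert (RtoC_K : forall x, x <> 0 -> (RtoC x * RtoC (/ x))%C = RtoC 1).
  { intros x hx. rewrite <- RtoC_mult. f_equal. now apply Rinv_r. }
  set (b := (RtoC (/ r) * a)%C).
  assert (hb : Cmod b < 1).
  { unfold b. rewrite Cmod_scal by lra. apply Rmult_lt_reg_l with r; [lra|].
    rewrite <- Rmult_assoc, Rinv_r by lra. lra. }
  assert (hbn : Cmod (- b) < 1) by now rewrite Cmod_opp.
  assert (b0 := Cmod_ge_0 b).
  set (xi := fun x => (RtoC (/ s) * x)%C).
  assert (hxi : forall x, Cmod x < 1 -> Cmod (xi x) < 1).
  { intros x hx. unfold xi. rewrite Cmod_scal by lra. assert (h := Cmod_ge_0 x). nra. }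
  exists (fun x => RtoC r * mobius b (xi x))%C.
  exists (fun x => RtoC (r / s) *
    ((1 - Cconj b * b) * / ((1 + Cconj b * xi x) * (1 + Cconj b * xi x))))%C.
  exists (fun z => RtoC s * mobius (- b) (RtoC (/ r) * z))%C.
  split; [|split; [|split]].
  - unfold xi. replace (RtoC (/ s) * 0)%C with (RtoC 0) by ring.
    rewrite mobius_0. unfold b. rewrite Cmult_assoc, RtoC_K by lra. ring.
  - intros x hx. assert (hx0 := Cmod_ge_0 x). assert (hy := hxi x hx).
    assert (hxih : holo_at xi x) by (apply holo_at_mult; [apply holo_at_const | apply holo_at_id]).
    assert (den := mobius_den b (xi x) hb ltac:(lra)).
    split; [|split; [|split; [|split]]].
    + rewrite Cmod_scal by lra. assert (h := mobius_lt_1 b (xi x) hb hy). nra.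
    + assert (D := cderiv_scal (RtoC r) _ _ _
        (cderiv_comp xi (mobius b) x _ _ (cderiv_scal (RtoC (/ s)) _ _ _ (cderiv_id x))
           (cderiv_mobius b (xi x) hb hy))).
      unfold Rdiv. rewrite RtoC_mult.
      match type of D with cderiv _ _ ?l => match goal with |- cderiv _ _ ?k =>
        replace k with l by (unfold Cdiv; ring) end end.
      exact D.
    + apply holo_at_mult; [apply holo_at_const|].
      apply holo_at_comp; [exact hxih | now apply holo_mobius].
    + apply holo_at_mult; [apply holo_at_const|].
      apply holo_at_mult; [apply holo_at_const|].
      apply holo_at_inv; [|now apply Cmult_neq_0].
      apply holo_at_mult; (apply holo_at_plus; [apply holo_at_const|];
        apply holo_at_mult; [apply holo_at_const | exact hxih]).
    (* The denominators on both sides are the same |1 + conj b xi|^2, and 1 - |x|^2 / 2 is 1 -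
       |xi|^2. *)
    + assert (E := one_minus_mobius b (xi x) hb ltac:(lra)).
      assert (dp := Cmod_pos _ den). set (D := Cmod (1 + Cconj b * xi x)) in *.
      rewrite Cmod_scal by (apply Rmult_le_pos; lra).
      rewrite Cmod_scal by lra.
      rewrite Cmod_mult, Cmod_inv, Cmod_mult by now apply Cmult_neq_0. fold D.
      replace (1 - Cconj b * b)%C with (RtoC (1 - Cmod b ^ 2))
        by (rewrite RtoC_minus, Cmod2_conj; ring).
      rewrite Cmod_R, Rabs_right by nra.
      set (M := Cmod (mobius b (xi x))) in *.
      replace (r ^ 2 - (r * M) ^ 2) with (r ^ 2 * (1 - M ^ 2)) by ring.
      rewrite E. unfold xi. rewrite Cmod_scal by lra.
      replace ((/ s * Cmod x) ^ 2) with (Cmod x ^ 2 / 2)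
        by (rewrite <- ss; field; lra).
      field. lra.
  - intros x hx. assert (hy := hxi x hx).
    replace (RtoC (/ r) * (RtoC r * mobius b (xi x)))%C with (mobius b (xi x)).
    + rewrite mobius_K by auto. unfold xi. rewrite Cmult_assoc, RtoC_K by lra. ring.
    + rewrite Cmult_assoc, (Cmult_comm (RtoC (/ r))), RtoC_K by lra. ring.
  - intros z hz. assert (hz' : Cmod (RtoC (/ r) * z) < 1).
    { rewrite Cmod_scal by lra. apply Rmult_lt_reg_l with r; [lra|].
      rewrite <- Rmult_assoc, Rinv_r by lra. lra. }
    split.
    + unfold xi. rewrite Cmult_assoc, (Cmult_comm (RtoC (/ s))), RtoC_K, Cmult_1_l by lra.
      assert (E := mobius_K (- b) (RtoC (/ r) * z) hbn hz').
      replace (- - b)%C with b in E by ring. rewrite E.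
      rewrite Cmult_assoc, RtoC_K by lra. ring.
    + apply ccont_mult; [apply ccont_const|].
      apply (ccont_comp (fun z => RtoC (/ r) * z)%C).
      * apply ccont_mult; [apply ccont_const | apply ccont_id].
      * now apply holo_at_cont, holo_mobius.
Qed.

Lemma univalent_disk_of_max K K' (f h g p q : C -> C) r a :
  1 <= K -> 0 <= K' ->
  (forall z, Cmod z < 1 -> f z = (h z + Cconj (g z))%C) ->
  (forall z, Cmod z < 1 ->
     (cderiv h z (p z) /\ holo_at p z) /\ (cderiv g z (q z) /\ holo_at q z)) ->
  (forall z, Cmod z < 1 -> Cmod (q z) <= Cmod (p z) /\
     (Cmod (p z) + Cmod (q z)) ^ 2 <= K * (Cmod (p z) ^ 2 - Cmod (q z) ^ 2) + K') ->
  0 < r <= 1 -> Cmod a < r ->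
  (forall z, Cmod z < r -> (Cmod (p z) - Cmod (q z)) * (r ^ 2 - Cmod z ^ 2)
                        <= (Cmod (p a) - Cmod (q a)) * (r ^ 2 - Cmod a ^ 2)) ->
  r <= (Cmod (p a) - Cmod (q a)) * (r ^ 2 - Cmod a ^ 2) ->
  exists c rho, rho1 K K' <= rho /\ univalent_disk f c rho.
Proof.
  intros hK hK' fhg dhg ell hr ha amax aval.
  destruct (mobius_chart r a ltac:(lra) ha) as [Phi [dPhi [Psi [Phi0 [HPhi [PsiK HPsi]]]]]].
  assert (s0 := Rlt_sqrt2_0). assert (ss : sqrt 2 * sqrt 2 = 2) by (apply sqrt_sqrt; lra).
  set (s := sqrt 2) in *.
  set (M := (Cmod (p a) - Cmod (q a)) * (r ^ 2 - Cmod a ^ 2)) in *.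
  (* [N] is lambda of f o Phi at 0; the hypothesis M >= r makes it at least 1 / sqrt 2. *)
  set (N := M / (s * r)).
  assert (sr : 0 < s * r) by (apply Rmult_lt_0_compat; lra).
  assert (NM : N * (s * r) = M) by (unfold N; field; split; lra).
  assert (hN : / s <= N).
  { apply Rmult_le_reg_r with (s * r); [exact sr|]. rewrite NM.
    replace (/ s * (s * r)) with r by (field; lra). exact aval. }
  assert (is : 0 < / s) by now apply Rinv_0_lt_compat.
  assert (N0 : 0 < N) by lra. assert (iN : 0 < / N) by now apply Rinv_0_lt_compat.
  assert (in_disk : forall x, Cmod x < 1 -> Cmod (Phi x) < 1).
  { intros x hx. destruct (HPhi x hx) as [A _]. lra. }
  (* The factor 2 bounds 1 / (1 - |x|^2 / 2) on the unit disk. *)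
  assert (dPhi_le : forall x, Cmod x < 1 ->
    Cmod (dPhi x) * (s * r) <= 2 * (r ^ 2 - Cmod (Phi x) ^ 2)).
  { intros x hx. destruct (HPhi x hx) as [_ [_ [_ [_ E]]]].
    assert (x0 := Cmod_ge_0 x). assert (d0 := Cmod_ge_0 (dPhi x)).
    assert (E' : Cmod (dPhi x) * (1 - Cmod x ^ 2 / 2) * (s * r) = r ^ 2 - Cmod (Phi x) ^ 2).
    { rewrite E. field. lra. }
    rewrite <- E'.
    assert (0 <= Cmod (dPhi x) * (s * r)) by (apply Rmult_le_pos; [exact d0 | now left]).
    replace (2 * (Cmod (dPhi x) * (1 - Cmod x ^ 2 / 2) * (s * r)))
      with (Cmod (dPhi x) * (s * r) * (2 - Cmod x ^ 2)) by field.
    assert (0 <= 1 - Cmod x ^ 2) by nra.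
    set (A := Cmod (dPhi x) * (s * r)) in *. clearbody A. nra. }
  destruct (rho1_landau K K' hK hK') as [hm E1]. cbv zeta in hm, E1.
  set (L := K + sqrt (K ^ 2 + 4 * K')) in *. set (m := L - / L) in *.
  fold s in E1.
  set (lam := fun x => (Cmod (p (Phi x)) - Cmod (q (Phi x))) * Cmod (dPhi x) / N).
  set (Lam := fun x => (Cmod (p (Phi x)) + Cmod (q (Phi x))) * Cmod (dPhi x) / N).
  assert (lam_le : forall x, Cmod x < 1 -> lam x <= 2).
  { intros x hx. unfold lam. destruct (ell _ (in_disk x hx)) as [le _].
    destruct (HPhi x hx) as [A _].
    assert (B := amax _ A). assert (D := dPhi_le x hx).
    apply Rmult_le_reg_r with (N * (s * r)); [now apply Rmult_lt_0_compat|].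
    replace ((Cmod (p (Phi x)) - Cmod (q (Phi x))) * Cmod (dPhi x) / N * (N * (s * r)))
      with ((Cmod (p (Phi x)) - Cmod (q (Phi x))) * (Cmod (dPhi x) * (s * r)))
      by (field; lra).
    rewrite NM. nra. }
  assert (Lam_ge : forall x, 0 <= Lam x).
  { intros x. unfold Lam, Rdiv. assert (b1 := Cmod_ge_0 (p (Phi x))).
    assert (b2 := Cmod_ge_0 (q (Phi x))). assert (b3 := Cmod_ge_0 (dPhi x)).
    repeat apply Rmult_le_pos; lra. }
  (* Rescaling multiplies K' by (|Phi'| / N)^2. As r <= 1, |Phi'| <= sqrt 2, and 1 / N <= sqrt 2, so
     this is at most 4. *)
  assert (Lam_sqr : forall x, Cmod x < 1 -> exists c, 0 <= c <= 4 /\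
    Lam x ^ 2 <= K * Lam x * lam x + K' * c).
  { intros x hx. exists ((Cmod (dPhi x) / N) ^ 2). split.
    - split; [apply pow2_ge_0|]. assert (D := dPhi_le x hx).
      assert (b3 := Cmod_ge_0 (dPhi x)). assert (b4 := pow2_ge_0 (Cmod (Phi x))).
      assert (D1 : Cmod (dPhi x) <= s).
      { apply Rmult_le_reg_r with (s * r); [exact sr|].
        replace (s * (s * r)) with (2 * r) by (rewrite <- ss; ring). nra. }
      assert (D2 : Cmod (dPhi x) / N <= 2).
      { apply Rmult_le_reg_r with N; [exact N0|].
        replace (Cmod (dPhi x) / N * N) with (Cmod (dPhi x)) by (field; lra).
        assert (s * / s = 1) by (apply Rinv_r; lra). nra. }
      assert (0 <= Cmod (dPhi x) / N) by (apply Rmult_le_pos; lra).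
      replace 4 with (2 ^ 2) by ring. apply pow_incr. lra.
    - destruct (ell _ (in_disk x hx)) as [_ E]. unfold Lam, lam.
      set (P := Cmod (p (Phi x))) in *. set (Q := Cmod (q (Phi x))) in *.
      set (d := Cmod (dPhi x)).
      replace (((P + Q) * d / N) ^ 2) with ((P + Q) ^ 2 * (d / N) ^ 2) by (field; lra).
      replace (K * ((P + Q) * d / N) * ((P - Q) * d / N) + K' * (d / N) ^ 2)
        with ((K * (P ^ 2 - Q ^ 2) + K') * (d / N) ^ 2) by (field; lra).
      apply Rmult_le_compat_r; [apply pow2_ge_0 | exact E]. }
  assert (Lam_le : forall x, Cmod x < 1 -> Lam x <= L).
  { intros x hx. destruct (Lam_sqr x hx) as [c [hc E]].
    exact (elliptic_bound K K' _ _ c hK hK' (Lam_ge x) hc (lam_le x hx) E). }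
  assert (z0 : Cmod 0 < 1) by (rewrite Cmod_0; lra).
  assert (lam0 : lam 0%C = 1).
  { destruct (HPhi 0%C z0) as [_ [_ [_ [_ E]]]]. unfold lam. fold s in E.
    rewrite Phi0, Cmod_0 in E. rewrite Phi0.
    replace (Cmod (dPhi 0%C)) with ((r ^ 2 - Cmod a ^ 2) / (s * r)) by lra.
    replace ((Cmod (p a) - Cmod (q a)) * ((r ^ 2 - Cmod a ^ 2) / (s * r)))
      with N by (unfold N, M; field; lra).
    field. lra. }
  (* Strictness comes from lambda being 1 rather than 2 at 0: Lambda = L would give L^2 <= K L + 4
     K', whereas L^2 = 2 K L + 4 K'. *)
  assert (Lam0 : Lam 0%C < L).
  { assert (A := Lam_le 0%C z0). destruct (Lam_sqr 0%C z0) as [c [hc E]].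
    rewrite lam0 in E. assert (S0 := sqrt_pos (K ^ 2 + 4 * K')).
    assert (hS : sqrt (K ^ 2 + 4 * K') * sqrt (K ^ 2 + 4 * K') = K ^ 2 + 4 * K')
      by (apply sqrt_sqrt; nra).
    assert (K' * c <= K' * 4) by (apply Rmult_le_compat_l; lra).
    apply Rnot_le_lt. intros hle. assert (EL : Lam 0%C = L) by lra.
    rewrite EL in E. unfold L in E. nra. }
  set (H := fun x => (RtoC (/ N) * h (Phi x))%C).
  set (G := fun x => (RtoC (/ N) * g (Phi x))%C).
  set (H' := fun x => (RtoC (/ N) * (p (Phi x) * dPhi x))%C).
  set (G' := fun x => (RtoC (/ N) * (q (Phi x) * dPhi x))%C).
  assert (absH : forall x, Cmod (H' x) = Cmod (p (Phi x)) * Cmod (dPhi x) / N).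
  { intros x. unfold H'. rewrite Cmod_scal, Cmod_mult by lra. unfold Rdiv. ring. }
  assert (absG : forall x, Cmod (G' x) = Cmod (q (Phi x)) * Cmod (dPhi x) / N).
  { intros x. unfold G'. rewrite Cmod_scal, Cmod_mult by lra. unfold Rdiv. ring. }
  assert (sumHG : forall x, Cmod (H' x) + Cmod (G' x) = Lam x).
  { intros x. rewrite absH, absG. unfold Lam. field. lra. }
  assert (diffHG : forall x, Cmod (H' x) - Cmod (G' x) = lam x).
  { intros x. rewrite absH, absG. unfold lam. field. lra. }
  assert (holoHG : forall x, Cmod x < 1 -> holo_at H' x /\ holo_at G' x).
  { intros x hx. destruct (HPhi x hx) as [_ [_ [hP [hdP _]]]].
    destruct (dhg _ (in_disk x hx)) as [[_ hp] [_ hq]].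
    split; (apply holo_at_mult; [apply holo_at_const|]; apply holo_at_mult; [|exact hdP];
      apply (holo_at_comp Phi); auto). }
  assert (LD := landau_disk H G H' G' m hm).
  destruct LD as [inj [surj inv]].
  { intros x hx. apply cderiv_scal. apply (cderiv_comp Phi h); [now apply HPhi|].
    now apply dhg, in_disk. }
  { intros x hx. apply cderiv_scal. apply (cderiv_comp Phi g); [now apply HPhi|].
    now apply dhg, in_disk. }
  { rewrite diffHG, lam0. lra. }
  { intros x hx. apply derivative_variation; auto.
    - intros; now apply holoHG.
    - intros; now apply holoHG.
    - intros y hy. rewrite sumHG. auto.
    - now rewrite sumHG.
    - rewrite diffHG, lam0. lra. }
  set (F := fun x => (H x + Cconj (G x))%C) in *.
  assert (hr0 : / (1 + m) < 1).
  { rewrite <- Rinv_1 at 2. apply Rinv_lt_contravar; lra. }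
  assert (NF : forall x, Cmod x < 1 -> f (Phi x) = (RtoC N * F x)%C).
  { intros x hx. rewrite fhg by auto. unfold F, H, G. rewrite Cmult_conj.
    replace (Cconj (RtoC (/ N))) with (RtoC (/ N))
      by (apply injective_projections; simpl; ring).
    transitivity ((RtoC N * RtoC (/ N)) * (h (Phi x) + Cconj (g (Phi x))))%C; [|ring].
    rewrite <- RtoC_mult, Rinv_r by lra. ring. }
  assert (NFd : forall x y, Cmod x < 1 -> Cmod y < 1 ->
    Cmod (f (Phi x) - f (Phi y)) = N * Cmod (F x - F y)).
  { intros x y hx hy. rewrite !NF by auto. rewrite <- Cmod_scal by lra. f_equal. ring. }
  set (R0 := 1 + m * ln (m / (1 + m))) in *.
  assert (hR0 : 0 < R0) by now apply landau_radius_pos.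
  assert (fa : f a = (RtoC N * F 0%C)%C) by (rewrite <- Phi0; now apply NF).
  (* Undoing the normalisation multiplies the radius by N >= 1 / sqrt 2, while [rho1] is R0 / sqrt
     2. *)
  exists (f a), (N * R0). split.
  { rewrite E1. unfold Rdiv. nra. }
  apply (PlaneTopology.univalent_disk_of_parametrization f Phi Psi (f a) (N * R0) (/ (1 + m))).
  - now apply Rmult_lt_0_compat.
  - intros z hz. destruct (dhg z hz) as [[d1 _] [d2 _]].
    apply (ccont_ext_loc (fun z => h z + Cconj (g z))%C f z (1 - Cmod z)); [lra | |].
    + intros w hw. symmetry. apply fhg. assert (T := Cmod_triangle_inv w z). lra.
    + apply ccont_plus; [|apply ccont_conj]; eapply cderiv_cont; eauto.
  - intros x hx. split; [apply in_disk; lra|].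
    apply holo_at_cont. apply HPhi. lra.
  - intros x hx. split; [apply PsiK; lra|]. apply HPsi. apply HPhi. lra.
  - intros x hx. destruct (HPhi x ltac:(lra)) as [A _]. exists (r - Cmod (Phi x)).
    split; [lra|]. intros w hw. apply HPsi. assert (T := Cmod_triangle_inv w (Phi x)). lra.
  - intros x y hx hy E. apply inj; auto.
    assert (Z := NFd x y ltac:(lra) ltac:(lra)). rewrite E, Cmod_minus_diag in Z.
    assert (p0 := Cmod_ge_0 (F x - F y)).
    assert (Z' : Cmod (F x - F y) = 0) by nra. apply Cmod_eq_0 in Z'.
    change (F x = F y). replace (F x) with ((F x - F y) + F y)%C by ring. rewrite Z'. ring.
  - intros w hw. destruct (surj (RtoC (/ N) * w)%C) as [x [hx E]].
    + apply Rmult_lt_reg_l with N; [exact N0|]. refine (Rle_lt_trans _ _ _ _ hw).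
      right. rewrite <- Cmod_scal by lra. f_equal. rewrite fa.
      change (RtoC N * (RtoC (/ N) * w - F 0%C) = w - RtoC N * F 0%C)%C.
      transitivity ((RtoC N * RtoC (/ N)) * w - RtoC N * F 0%C)%C; [ring|].
      rewrite <- RtoC_mult, Rinv_r by lra. ring.
    + exists x. split; [exact hx|]. rewrite NF by lra. change (F x = RtoC (/ N) * w)%C in E.
      rewrite E, Cmult_assoc, <- RtoC_mult, Rinv_r by lra. ring.
  - intros x hx hfx eps he. rewrite <- Phi0, NFd in hfx by lra.
    destruct (inv x hx) with eps as [d [hd Hd]]; [|exact he|].
    { apply Rmult_lt_reg_l with N; [exact N0 | exact hfx]. }
    exists (N * d). split; [now apply Rmult_lt_0_compat|]. intros y hy hfy.
    rewrite NFd in hfy by lra. apply Hd; auto.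
    apply Rmult_lt_reg_l with N; [exact N0 | exact hfy].
Qed.

(** The weight vanishes on the circle |z| = r, while the maximum over the closed disk is at least r
    > 0, so it is attained inside. *)
Lemma exists_weighted_max (p q : C -> C) r z : 0 < r < 1 ->
  (forall z, Cmod z < 1 -> ccont p z /\ ccont q z) -> Cmod z < r ->
  r <= (Cmod (p z) - Cmod (q z)) * (r ^ 2 - Cmod z ^ 2) ->
  exists a, Cmod a < r /\ r <= (Cmod (p a) - Cmod (q a)) * (r ^ 2 - Cmod a ^ 2) /\
  forall z, Cmod z < r -> (Cmod (p z) - Cmod (q z)) * (r ^ 2 - Cmod z ^ 2)
                       <= (Cmod (p a) - Cmod (q a)) * (r ^ 2 - Cmod a ^ 2).
Proof.
  intros hr hc hz hv.
  set (phi := fun z => (Cmod (p z) - Cmod (q z)) * (r ^ 2 - Cmod z ^ 2)).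
  destruct (PlaneTopology.closed_disk_max phi r) as [a [ha Ha]]; [lra | |].
  - intros w hw. destruct (hc w ltac:(lra)) as [cp cq].
    set (Phi := fun w => ((RtoC (Cmod (p w)) + - RtoC (Cmod (q w)))
      * (RtoC (r ^ 2) + - (RtoC (Cmod w) * RtoC (Cmod w))))%C).
    assert (cPhi : ccont Phi w).
    { apply ccont_mult; apply ccont_plus; auto using ccont_const, ccont_opp, ccont_Cmod.
      apply ccont_opp, ccont_mult; apply (ccont_Cmod (fun w => w)), ccont_id. }
    intros eps he. destruct (cPhi eps he) as [d [hd Hd]]. exists d. split; [exact hd|].
    intros v _ hvw. refine (Rle_lt_trans _ _ _ _ (Hd v hvw)).
    refine (Rle_trans _ _ _ _ (fst_le_Cmod _)). right. f_equal.
    unfold phi, Phi. simpl. ring.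
  - assert (hpa : r <= phi a) by (refine (Rle_trans _ _ _ hv (Ha z _)); lra).
    exists a. split; [|split].
    + destruct ha as [ha|ha]; [exact ha|]. exfalso. unfold phi in hpa. rewrite ha in hpa. lra.
    + exact hpa.
    + intros w hw. apply Ha. lra.
Qed.

(** * Choice of the radius and of the extremal point *)

Theorem theorem3 (K K' : R) (f h g : C -> C)
  (hK : 1 <= K) (hK' : 0 <= K')
  (h_an : analytic_on_disk h) (g_an : analytic_on_disk g)
  (g0 : g (RtoC 0) = RtoC 0)
  (f_hg : forall z : C, unit_disk z -> f z = Cplus (h z) (Cconj (g z)))
  (f_harm : harmonic_on_disk f)
  (f_ell : elliptic K K' f)
  (f0 : f (RtoC 0) = RtoC 0)
  (lambda_f0 : small_lambda f (RtoC 0) = 1) :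
  exists (c : C) (r : R), rho1 K K' <= r /\ univalent_disk f c r.
Proof.
  assert (W := Wirtinger_holo f h g f_harm h_an g_an f_hg).
  assert (cpq : forall z, Cmod z < 1 -> ccont (dz f) z /\ ccont (fun w => Cconj (dzbar f w)) z).
  { intros z hz. destruct (W z hz) as [[_ a] [_ b]].
    split; now apply holo_at_cont. }
  assert (ell := elliptic_pointwise K K' f f_ell cpq).
  set (p := dz f) in *. set (q := fun w => Cconj (dzbar f w)) in *.
  assert (z0 : Cmod 0 < 1) by (rewrite Cmod_0; lra).
  assert (l0 : Cmod (p 0%C) - Cmod (q 0%C) = 1).
  { destruct (ell 0%C z0) as [le _]. unfold small_lambda in lambda_f0.
    unfold q, p in *. rewrite Cmod_conj in *. rewrite Rabs_right in lambda_f0; lra. }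
  destruct (Classical_Prop.classic (exists z, Cmod z < 1 /\
    1 < (Cmod (p z) - Cmod (q z)) * (1 - Cmod z ^ 2))) as [[z [hz hv]]|hn].
  - set (l := Cmod (p z) - Cmod (q z)) in *. set (x := Cmod z) in *.
    assert (x0 : 0 <= x) by apply Cmod_ge_0.
    assert (x1 : 0 <= 1 - x ^ 2) by nra.
    assert (l1 : 0 < l) by (clearbody l; apply Rnot_le_lt; intros hle; nra).
    (* [V] is the excess over the value 1 at the origin. Shrinking the radius to 1 - d costs at most
       2 l d <= V, so the value at [z] remains at least 1, which exceeds 1 - d; the other bound on
       [d] keeps [z] inside the smaller disk. *)
    set (V := l * (1 - x ^ 2) - 1).
    set (d := Rmin (V / (2 * l)) ((1 - x) / 2)).
    assert (hd : 0 < d).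
    { apply Rmin_pos; [apply Rdiv_lt_0_compat; unfold V; lra | lra]. }
    assert (m1 := Rmin_l (V / (2 * l)) ((1 - x) / 2)).
    assert (m2 := Rmin_r (V / (2 * l)) ((1 - x) / 2)). fold d in m1, m2.
    assert (m3 : 2 * l * d <= V).
    { apply Rle_trans with (2 * l * (V / (2 * l))); [apply Rmult_le_compat_l; lra|].
      right. field. lra. }
    destruct (exists_weighted_max p q (1 - d) z) as [a [ha [hav Ha]]]; auto; fold x; try lra.
    { fold l. unfold V in m3. nra. }
    apply (univalent_disk_of_max K K' f h g p q (1 - d) a); auto. lra.
  - apply (univalent_disk_of_max K K' f h g p q 1 0%C); auto; try lra.
    + intros z hz. rewrite l0, Cmod_0. apply Rnot_lt_le. intros hlt.
      apply hn. exists z. split; [exact hz|]. lra.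
    + rewrite l0, Cmod_0. lra.
Qed.
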